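(* Let $X$ be a proper NPC space, and let $G$ be a totally disconnected, locally compact group acting properly and locally discretely by isometries on $X$. Let $g \in G$ be hyperbolic, let $Y$ be a nonempty closed convex $\langle g\rangle$-invariant subspace of $X$ and let $K = \mathrm{Fix}_G(Y)$. Then the following are equivalent: (a) $\mathrm{con}_G(g/K)$ is closed in $G$; (b) $\mathrm{nub}_G(g)$ fixes $Y$ pointwise; (c) for some (equivalently, all) $x \in X$, the set of fixed points in $X$ of $\mathrm{con}_G(g/K)_x := \mathrm{con}_G(g/K)\cap G_x$ is absorbing for $\xi_-(g)$ within $Y$.
   Context: An NPC space is a geodesic metric space $X$ that is either (1) complete and CAT(0), or (2) proper (closed balls are compact) and $\delta$-hyperbolic for some $\delta \ge 0$ (every geodesic triangle is $\delta$-thin: each point on a side lies within distance $\delta$ of a point on another side); here $X$ is moreover assumed proper in both cases. The boundary $\partial X$ is the set of equivalence classes of geodesic rays, where $\gamma_1\sim\gamma_2$ if $d(\gamma_1(t),\gamma_2(t))$ is bounded over $t\ge 0$. Convergence of sequences in $X$ to boundary points is in the usual sense (cone topology for CAT(0) spaces, Gromov boundary for $\delta$-hyperbolic spaces). An isometry $g$ is hyperbolic if: in case (1), it has an axis, i.e. there are a geodesic line $\gamma:\mathbb{R}\to X$ and $k>0$ with $g\gamma(t)=\gamma(t+k)$ for all $t$; in case (2), $n\mapsto g^nx$ is a quasi-isometric embedding of $\mathbb{Z}$ into $X$ for some (equivalently any) $x$. The repelling point $\xi_-(g)\in\partial X$ is the point with $g^{-n}x\to\xi_-(g)$ as $n\to+\infty$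 for all $x\in X$ (it exists for hyperbolic $g$). An isometric action of $G$ on $X$ is proper if for all $x\in X$, $r>0$ the set $\{g\in G: d(gx,x)\le r\}$ has compact closure; it is locally discrete if around each point of $X$ there is a ball of positive radius whose fixator (pointwise stabilizer) in $G$ is open. $\mathrm{Fix}_G(Y)$ is the pointwise stabilizer of $Y$ in $G$. For a closed $\langle g\rangle$-invariant subgroup $K\le G$, $\mathrm{con}_G(g/K)=\{h\in G: g^nhg^{-n}K\to K\text{ in }G/K\text{ as }n\to+\infty\}$. A compact open subgroup $U$ of $G$ is minimizing (equivalently, tidy) for $g$ if it attains the minimum of $|gUg^{-1}:U\cap gUg^{-1}|$ over all compact open subgroups of $G$. The nub $\mathrm{nub}_G(g)$ is the intersection of all minimizing (tidy) subgroups for $g$ in $G$. Absorbing sets: let $Y$ be a closed convex subspace of $X$, $\xi\in\partial X$ and $Z\subseteq X$. $Z$ is an absorbing set for $\xi$ within $Y$ if for some (equivalently, all) geodesic rays $\rho:\mathbb{R}_{\ge 0}\to X$ representing $\xi$, for all sufficiently large $t$ we have $\{y\in Y: d(\rho(t),y)\le r_t\}\subseteq Z$ for some $r_t$ such that $r_t\to+\infty$ as $t\to+\infty$. *)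

(* Defs.v *)
From HB Require Import structures.
From mathcomp Require Import all_boot all_order all_algebra.
From mathcomp Require Import monoid.
From mathcomp Require Import all_classical all_reals all_analysis.

Set Implicit Arguments.
Unset Strict Implicit.
Unset Printing Implicit Defensive.

Import Order.TTheory GRing.Theory Num.Theory.
Import numFieldTopology.Exports.

Local Open Scope classical_set_scope.
Local Open Scope ring_scope.

HB.structure Definition PreTopologicalGroup :=
  {G of Topological G & Group G}.

HB.mixin Record isTopologicalGroup G of PreTopologicalGroup G := {
  mulg_continuous : continuous (fun x : G * G => (x.1 * x.2)%g);
  invg_continuous : continuous (fun x : G => (x^-1)%g)
}.

#[short(type="topologicalGroupType")]
HB.structure Definition TopologicalGroup :=
  {G of PreTopologicalGroup G & isTopologicalGroup G}.

Section TopGroupDefs.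
Context {G : topologicalGroupType}.
Implicit Types (g h : G) (H K L U : set G).

Definition zexpg g (n : int) : G :=
  match n with Posz m => (g ^+ m)%g | Negz m => (g ^- m.+1)%g end.

Definition subgroup H :=
  H 1%g /\ forall x y, H x -> H y -> H (x * y^-1)%g.

Definition conj_set g H : set G := [set (g * h * g^-1)%g | h in H].

Definition left_coset h K : set G := [set (h * k)%g | k in K].

(* The number of left cosets of L in H is the index |H : L|. *)
Definition left_cosets H L : set (set G) := [set left_coset h L | h in H].

(* Convergence of [u n K] to [a K] in G / K for the quotient topology: a set W
   of cosets is open when its preimage under the projection is open in G. *)
Definition cvg_coset K (u : nat -> G) (a : G) :=
  forall W : set (set G), open [set x | W (left_coset x K)] ->
    W (left_coset a K) -> \forall n \near \oo, W (left_coset (u n) K).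

(* con_G(g/K), for K invariant under conjugation by g. *)
Definition con g K : set G :=
  [set h | cvg_coset K (fun n => g ^+ n * h * g ^- n)%g 1%g].

Definition compact_open_subgroup U := [/\ subgroup U, compact U & open U].

(* Compared as cardinals; the indices are finite for compact open subgroups. *)
Definition minimizing g U :=
  compact_open_subgroup U /\
  forall V, compact_open_subgroup V ->
    (left_cosets (conj_set g U) (U `&` conj_set g U) #<=
     left_cosets (conj_set g V) (V `&` conj_set g V))%card.

Definition nub g : set G := \bigcap_(U in [set U | minimizing g U]) U.

End TopGroupDefs.

Section MetricDefs.
Context {R : realType} {X : metricType R}.

(* Paths are total functions on R; only the values on the relevant interval
   ([0, d(x, y)] for segments, [0, +oo[ for rays) matter. *)
Definition geodesic_segment (x y : X) (c : R -> X) :=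
  [/\ c 0 = x, c (mdist x y) = y &
    {in `[0, mdist x y] &, forall s t, mdist (c s) (c t) = `|s - t|}].

Definition geodesic_ray (c : R -> X) :=
  forall s t, 0 <= s -> 0 <= t -> mdist (c s) (c t) = `|s - t|.

Definition geodesic_line (c : R -> X) :=
  forall s t, mdist (c s) (c t) = `|s - t|.

Definition convex_subspace (Y : set X) :=
  forall x y, Y x -> Y y ->
    (exists c, geodesic_segment x y c) /\
    forall c, geodesic_segment x y c -> forall t, t \in `[0, mdist x y] -> Y (c t).

(* Vertices v and sides c indexed cyclically by Z/3: side i runs from v i to
   v (i + 1). *)
Definition geodesic_triangle (v : 'I_3 -> X) (c : 'I_3 -> R -> X) :=
  forall i, geodesic_segment (v i) (v (i + 1)) (c i).

Definition side_length (v : 'I_3 -> X) (i : 'I_3) : R := mdist (v i) (v (i + 1)).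

Definition thin_triangle (delta : R) (v : 'I_3 -> X) (c : 'I_3 -> R -> X) :=
  forall i s, s \in `[0, side_length v i] ->
    exists j t, [/\ j != i, t \in `[0, side_length v j] &
      mdist (c i s) (c j t) <= delta].

Definition plane_dist (p q : R * R) : R :=
  Num.sqrt ((p.1 - q.1) ^+ 2 + (p.2 - q.2) ^+ 2).

Definition comparison_triangle (v : 'I_3 -> X) (w : 'I_3 -> R * R) :=
  forall i, plane_dist (w i) (w (i + 1)) = side_length v i.

(* p is the point of the side [w i, w (i + 1)] at distance s from w i. *)
Definition comparison_point (w : 'I_3 -> R * R) (i : 'I_3) (s : R) (p : R * R) :=
  plane_dist (w i) p = s /\
  plane_dist p (w (i + 1)) = plane_dist (w i) (w (i + 1)) - s.

Definition CAT0_triangle (v : 'I_3 -> X) (c : 'I_3 -> R -> X) :=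
  forall w, comparison_triangle v w ->
    forall i j s t p q,
      s \in `[0, side_length v i] -> t \in `[0, side_length v j] ->
      comparison_point w i s p -> comparison_point w j t q ->
      mdist (c i s) (c j t) <= plane_dist p q.

Definition asymptotic (c1 c2 : R -> X) :=
  exists M, forall t, 0 <= t -> mdist (c1 t) (c2 t) <= M.

Definition ray_class (c : R -> X) : set (R -> X) :=
  [set c' | geodesic_ray c' /\ asymptotic c c'].

Definition boundary : set (set (R -> X)) :=
  [set ray_class c | c in geodesic_ray].

(* Convergence to xi in the cone topology: a basic neighbourhood of xi consists
   of the points x at distance more than r from c 0 such that the geodesic from
   c 0 to x is at distance less than e from c at time r, for c a ray in xi. *)
Definition cvg_cone (u : nat -> X) (xi : set (R -> X)) :=
  forall c, xi c -> forall r e : R, 0 < r -> 0 < e ->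
    \forall n \near \oo, r < mdist (c 0) (u n) /\
      forall s, geodesic_segment (c 0) (u n) s -> mdist (s r) (c r) < e.

Definition gromov_product (o x y : X) : R :=
  (mdist x o + mdist y o - mdist x y) / 2.

(* u converges at infinity to the point of the Gromov boundary given by the rays
   in xi: the Gromov products of u n and c t tend to infinity with n and t. *)
Definition cvg_gromov (u : nat -> X) (xi : set (R -> X)) :=
  forall c, xi c -> forall (o : X) (A : R),
    \forall n \near \oo & t \near +oo, A <= gromov_product o (u n) (c t).

Definition absorbing (Y : set X) (xi : set (R -> X)) (Z : set X) :=
  exists2 c, xi c & exists2 r : R -> R, r t @[t --> +oo] --> +oo &
    \forall t \near +oo, [set y | Y y /\ mdist (c t) y <= r t] `<=` Z.

(* The choice of the ray in xi is immaterial. *)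
Lemma absorbing_all Y xi Z : boundary xi -> absorbing Y xi Z ->
  forall c, xi c -> exists2 r : R -> R, r t @[t --> +oo] --> +oo &
    \forall t \near +oo, [set y | Y y /\ mdist (c t) y <= r t] `<=` Z.
Proof.
move=> [c0 c0r <-] [c1 [c1r [M1 a1]] [r rc rZ]] c [cr [M2 a2]].
exists (fun t => r t - (M1 + M2)).
  apply/cvgryPge => A; have /cvgryPge/(_ (A + (M1+M2))) := rc.
  by apply: filterS => t; rewrite lerBrDr.
near=> t; move=> y [Yy dy].
have t0 : 0 <= t by near: t; exact: nbhs_pinfty_ge.
have sub : [set y | Y y /\ mdist (c1 t) y <= r t] `<=` Z by near: t.
apply: sub; split=> //.
apply: (le_trans (metric_triangle _ (c t) _)).
rewrite lerBrDl in dy; apply: le_trans dy; rewrite lerD2r.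
apply: (le_trans (metric_triangle _ (c0 t) _)).
by rewrite metric_sym; apply: lerD; [exact: a1|exact: a2].
Unshelve. all: by end_near.
Qed.

End MetricDefs.

Section Spaces.
Context {R : realType} (X : metricType R).

Definition geodesic_space := forall x y : X, exists c, geodesic_segment x y c.

Definition proper_space := forall (x : X) (r : R), compact [set y | mdist x y <= r].

Definition complete_space :=
  forall F : set_system X, ProperFilter F -> cauchy F -> exists x : X, F --> x.

Definition CAT0_space :=
  geodesic_space /\
  forall v (c : 'I_3 -> R -> X), geodesic_triangle v c -> CAT0_triangle v c.

Definition hyperbolic_space (delta : R) :=
  geodesic_space /\
  forall v (c : 'I_3 -> R -> X), geodesic_triangle v c -> thin_triangle delta v c.

End Spaces.

(* The two kinds of NPC spaces; hyperbolic isometries and convergence to boundary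
   points are defined separately for each kind. *)
Inductive npc_kind := CAT0_kind | hyperbolic_kind.

Definition NPC_space (k : npc_kind) {R : realType} (X : metricType R) :=
  match k with
  | CAT0_kind => complete_space X /\ CAT0_space X
  | hyperbolic_kind =>
      proper_space X /\ exists2 delta : R, 0 <= delta & hyperbolic_space X delta
  end.

Definition cvg_boundary (k : npc_kind) {R : realType} {X : metricType R}
    (u : nat -> X) (xi : set (R -> X)) :=
  match k with
  | CAT0_kind => cvg_cone u xi
  | hyperbolic_kind => cvg_gromov u xi
  end.

Section ActionDefs.
Context {R : realType} {X : metricType R} {G : topologicalGroupType}.
Variable act : G -> X -> X.

Definition isometric_action :=
  [/\ forall x, act 1%g x = x,
      forall g h x, act (g * h)%g x = act g (act h x) &
      forall g x y, mdist (act g x) (act g y) = mdist x y].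

Definition fixator (Y : set X) : set G :=
  [set h | forall y, Y y -> act h y = y].

Definition stabilizer (x : X) : set G := [set h | act h x = x].

Definition fixed_points (H : set G) : set X :=
  [set x | forall h, H h -> act h x = x].

Definition proper_action :=
  forall (x : X) (r : R), compact (closure [set h | mdist (act h x) x <= r]).

Definition locally_discrete_action :=
  forall x : X, exists2 e : R, 0 < e & open (fixator (ball x e)).

Definition has_axis (g : G) :=
  exists c : R -> X, geodesic_line c /\
    exists2 k : R, 0 < k & forall t, act g (c t) = c (t + k).

Definition qi_embedded_orbit (g : G) (x : X) :=
  exists L A : R, [/\ 1 <= L, 0 <= A & forall m n : int,
    let d := mdist (act (zexpg g m) x) (act (zexpg g n) x) in
    L^-1 * `|m - n|%:~R - A <= d <= L * `|m - n|%:~R + A].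

Definition hyperbolic_isometry (k : npc_kind) (g : G) :=
  match k with
  | CAT0_kind => has_axis g
  | hyperbolic_kind => exists x : X, qi_embedded_orbit g x
  end.

(* xi_-(g), by definite description. *)
Definition repelling_point (k : npc_kind) (g : G) : set (R -> X) :=
  get [set xi | boundary xi /\
    forall x, cvg_boundary k (fun n => act (g ^- n)%g x) xi].

End ActionDefs.

(* Main.v *)
Require Import Defs.
From mathcomp Require Import all_boot all_order all_algebra.
From mathcomp Require Import monoid finmap.
From mathcomp Require Import all_classical all_reals all_analysis.
From mathcomp Require Import zify ring lra.

(** Why the theorem holds.

Fix y in Y and let V_r be the pointwise stabilizer of the part of Y in the
closed ball of radius r about y. Since the action is proper and locally
discrete and X is proper, the V_r are compact open subgroups; they decrease to
K. Hence h lies in con(g/K) iff, for each r, g^n h g^-n is in V_r for all large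
n, that is, h fixes Y near g^-n y up to distance r. The points g^-n y stay
within bounded distance of a ray of xi_-(g), along which they advance linearly
([repelling_ray]), so condition (c) at x says that the bound on n can be chosen
uniformly over con(g/K) meet G_x ([uniformly_contracted], [absorbing_uniform],
[uniform_absorbing]). Everything else takes place in the group G.

(c) => (a): a uniform bound is a closed condition, so con(g/K) is closed inside
the open subgroup G_x, hence closed ([closed_con]).

For the other implications, write P_+, P_-, P_0, P_-- for the elements whose
conjugates g^n h g^-n lie in the compact open subgroup P for all n <= 0, for
all n >= 0, for all n, for all large n. A subgroup is tidy when P = P_+ P_-
([tidy_above]) and P_+ meets P_-- only inside P_- ([tidy_below]).

(a) => (b): intersecting V_r with finitely many of its conjugates gives P inside
V_r, still containing K, that is tidy above ([tidy_above_conj_cap]). For such P,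
successive approximation along a chain of subgroups shrinking to K shows
P_-- = con(g/K) P_0 ([eventual_con_core]). When con(g/K) is closed, its
intersection with P is compact, and a Baire-type argument
([uniform_eventually]) bounds n uniformly there, so P is tidy below
([uniform_tidy_below]). Tidy subgroups are minimizing, so the nub lies in every
V_r, hence in K ([nub_sub_of_closed_con]).

(b) => (c): every minimizing U is tidy, so an element of U that is eventually
in U under conjugation never leaves U. This property passes to finite
intersections, and when the nub is in K compactness provides W inside P with
it. As con(g/K) is inside P_-- = W_-- P_0, and the elements of W_-- in a compact
set are conjugated into W from a common time on, the bound is uniform
([uniform_of_nub_sub]).

That tidy and minimizing agree rests on growth rates. If V is tidy and U tidy
above, of conjugation indices v and u, then v^n is at most c u^n, because the
indices of the n-th conjugates of two compact open subgroups differ by a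
bounded factor; and an element violating tidiness below of U produces 2^m
cosets by taking products of its translates, whence 2^m v^n <= c u^n with n
proportional to m ([growth_comparison], [minimizing_tidy_below]). This needs one
tidy subgroup ([tidy_exists]): if U is tidy above, the elements attracted into U
by both g and its inverse form a set with compact closure L, and Q L is tidy,
for Q inside U tidy above and normalized by L.

Geometry: in the CAT(0) case the ray is half of the axis, and contraction of
geodesics towards a common end point determines its class. In the hyperbolic
case the four point inequality makes d(x, g^n x) differ from a linear function
of n by a bounded amount ([rough_geodesic]); a limit of segments from x to
g^-n x is then the required ray ([limit_ray]). *)

Set Implicit Arguments.
Unset Strict Implicit.
Unset Printing Implicit Defensive.

Import Order.TTheory GRing.Theory Num.Theory.
Local Open Scope classical_set_scope.
Local Open Scope ring_scope.

(** * Conjugation by integer powers *)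
Section IntegerPowers.
Context {G : topologicalGroupType}.
Implicit Types (g h x y : G) (m n : int).

Lemma zexpg_succ g n : zexpg g (n + 1) = (g * zexpg g n)%g.
Proof.
case: n => n.
  by have -> : Posz n + 1 = n.+1 by [lia]; rewrite /= expgS.
case: n => [|n]; first by rewrite /= expg1 mulgV.
have -> : Negz n.+1 + 1 = Negz n by lia.
by rewrite /= [in RHS]expgSr invgM mulgA mulgV mul1g.
Qed.

Lemma zexpgD g m n : zexpg g (m + n) = (zexpg g m * zexpg g n)%g.
Proof.
elim/int_rec: m => [|m IH|m IH].
- by rewrite add0r mul1g.
- have -> : m.+1%:Z + n = (m%:Z + n) + 1 by lia.
  by rewrite zexpg_succ IH intS addrC zexpg_succ mulgA.
- apply: (@mulgI _ g); rewrite -zexpg_succ mulgA -zexpg_succ.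
  have -> : - m.+1%:Z + n + 1 = - m%:Z + n by lia.
  by have -> : - m.+1%:Z + 1 = - m%:Z by lia.
Qed.

Lemma zexpgN g n : zexpg g (- n) = (zexpg g n)^-1%g.
Proof. by apply/esym/mulg1_eq; rewrite -zexpgD subrr. Qed.

Lemma zexpVg g n : zexpg g^-1%g n = zexpg g (- n).
Proof.
case: n => n; rewrite zexpgN /= ?expVgn //.
Qed.

(** Locked, because a conjugate is itself a product and would otherwise match the
rule for the conjugate of a product. *)
Definition conjz g n h := locked (zexpg g n * h * (zexpg g n)^-1)%g.

Lemma conjz_def g n h : conjz g n h = (zexpg g n * h * (zexpg g n)^-1)%g.
Proof. by rewrite /conjz -lock. Qed.

Lemma conjzE g (n : nat) h : conjz g n h = (g ^+ n * h * g ^- n)%g.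
Proof. by rewrite conjz_def. Qed.

Lemma conjzD g m n h : conjz g (m + n) h = conjz g m (conjz g n h).
Proof. by rewrite !conjz_def zexpgD invgM !mulgA. Qed.

Lemma conjz0 g h : conjz g 0 h = h.
Proof. by rewrite conjz_def /= invg1 mulg1 mul1g. Qed.

Lemma conjz_id g n h : n = 0 -> conjz g n h = h.
Proof. by move=> ->; exact: conjz0. Qed.

Lemma conjzK g n h : conjz g (- n) (conjz g n h) = h.
Proof. by rewrite -conjzD addNr conjz0. Qed.

Lemma conjzKV g n h : conjz g n (conjz g (- n) h) = h.
Proof. by rewrite -conjzD subrr conjz0. Qed.

Lemma conjzM g n h k : conjz g n (h * k)%g = (conjz g n h * conjz g n k)%g.
Proof. by rewrite !conjz_def !mulgA mulgVK. Qed.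

Lemma conjzV g n h : conjz g n h^-1%g = (conjz g n h)^-1%g.
Proof. by rewrite !conjz_def !invgM invgK mulgA. Qed.

Lemma conjz1 g n : conjz g n 1%g = 1%g.
Proof. by rewrite conjz_def mulg1 mulgV. Qed.

Lemma conjVz g n h : conjz g^-1%g n h = conjz g (- n) h.
Proof. by rewrite !conjz_def zexpVg. Qed.

End IntegerPowers.

(** * Compactness and topological groups *)
Section Compactness.

Lemma compact_finite_cover (T : topologicalType) (A : set T) (U : T -> set T) :
  compact A -> (forall x, A x -> nbhs x (U x)) ->
  exists D : {fset T}, forall y, A y -> exists2 x, x \in D & U x y.
Proof.
move=> /compact_near_coveringP nc AU.
pose F := filter_from [set: {fset T}] (fun D => [set D' | D `<=` D']%fset).
have FF : Filter F.
  apply: filter_from_filter; first by exists fset0.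
  move=> D E _ _; exists (D `|` E)%fset => // D' /= DED'.
  by split; apply: fsubset_trans DED'; [exact: fsubsetUl|exact: fsubsetUr].
have [] := nc _ F (fun D y => exists2 x, x \in D & U x y) FF.
  move=> x Ax; exists (U x, [set D' | [fset x] `<=` D']%fset) => /=.
    by split; [exact: AU|exists [fset x]%fset].
  by move=> [y D'] /= [Uxy xD']; exists x => //; rewrite fsub1set in xD'.
by move=> D _ /(_ D (fsubset_refl D)) AD; exists D => y; exact: AD.
Qed.

(** At a point outside [O], some [A m] is missed by a whole neighbourhood; near
coverings then make the choice of [m] uniform. *)
Lemma nested_compact_sub (T : topologicalType) (A : nat -> set T) (O : set T) :
  compact (A 0%N) -> (forall n, closed (A n)) ->
  (forall n, A n.+1 `<=` A n) -> open O -> \bigcap_n A n `<=` O ->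
  exists n, A n `<=` O.
Proof.
move=> cA clA decA oO AO.
have dec m n : (m <= n)%N -> A n `<=` A m.
  move=> /subnK <-; elim: (n - m)%N => // k IH x /decA; exact: IH.
have /compact_near_coveringP nc := cA.
have [] : \forall n \near \oo, A 0%N `<=` (fun x => A n x -> O x).
  apply: (nc nat \oo (fun n x => A n x -> O x)) => x _.
  have [Ox|nOx] := pselect (O x).
    exists (O, setT) => /=; first by split; [exact: open_nbhs_nbhs|exact: filterT].
    by move=> [y n] [].
  have [m nAm] : exists m, ~ A m x.
    by apply: contrapT => /forallNP nA; apply: nOx; apply: AO => n _;
       apply: contrapT; exact: nA.
  exists (~` A m, [set n | (m <= n)%N]) => /=.
    split; first by apply: open_nbhs_nbhs; split => //; rewrite openC; exact: clA.
    by exists m.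
  by move=> [y n] /= [nAy mn] Any; exfalso; apply: nAy; exact: dec Any.
move=> n _ /(_ n (leqnn n)) An; exists n => x Ax.
by apply: An => //; exact: (dec 0%N n).
Qed.

Lemma nested_compact_nonempty (T : topologicalType) (A : nat -> set T) :
  compact (A 0%N) -> (forall n, closed (A n)) ->
  (forall n, A n.+1 `<=` A n) -> (forall n, A n !=set0) ->
  exists x : T, forall n, A n x.
Proof.
move=> cA clA decA neA; apply: contrapT => /forallNP nx.
have [|n] := nested_compact_sub cA clA decA open0.
  by move=> x Ax; apply: (nx x) => n; exact: Ax.
by have [x Ax] := neA n => /(_ x Ax).
Qed.

End Compactness.

Section TopologicalGroup.
Context {G : topologicalGroupType}.
Implicit Types (g h x y : G) (H K U : set G).

Lemma subgroup1 H : subgroup H -> H 1%g. Proof. by case. Qed.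

Lemma subgroupV H x : subgroup H -> H x -> H x^-1%g.
Proof. by move=> [H1 HB] Hx; rewrite -[(x^-1)%g]mul1g; exact: HB. Qed.

Lemma subgroupM H x y : subgroup H -> H x -> H y -> H (x * y)%g.
Proof.
move=> sH Hx Hy; rewrite -[y]invgK; apply: (sH.2) => //; exact: subgroupV.
Qed.

Lemma subgroupI H K : subgroup H -> subgroup K -> subgroup (H `&` K).
Proof.
move=> sH sK; split; first by split; exact: subgroup1.
by move=> x y [Hx Kx] [Hy Ky]; split; [apply: sH.2|apply: sK.2].
Qed.

Lemma mulg_cvg x y (W : set G) : nbhs (x * y)%g W ->
  \forall x' \near x & y' \near y, W (x' * y')%g.
Proof. by move=> Wxy; apply: (@mulg_continuous G (x, y)). Qed.

Lemma mulgl_continuous x : continuous (fun y : G => (x * y)%g).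
Proof.
move=> y W Wxy; have := mulg_cvg Wxy.
by case=> -[A B] /= [Ax By] AB; apply: filterS By => z Bz; apply: (AB (x, z));
  split=> //=; exact: nbhs_singleton.
Qed.

Lemma mulgr_continuous x : continuous (fun y : G => (y * x)%g).
Proof.
move=> y W Wxy; have := mulg_cvg Wxy.
by case=> -[A B] /= [Ax By] AB; apply: filterS Ax => z Bz; apply: (AB (z, x));
  split=> //=; exact: nbhs_singleton.
Qed.

Lemma conjz_continuous g n : continuous (conjz g n).
Proof.
have -> : conjz g n = fun h => (zexpg g n * h * (zexpg g n)^-1)%g.
  by apply/funext => h; rewrite conjz_def.
move=> h.
apply: (@continuous_comp _ _ _ (fun y => zexpg g n * y)%g
   (fun y => y * (zexpg g n)^-1)%g); first exact: mulgl_continuous.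
exact: mulgr_continuous.
Qed.

Lemma open_mull x U : open U -> open [set y | U (x * y)%g].
Proof. by move=> oU; apply: (open_comp _ oU) => y _; exact: mulgl_continuous. Qed.

Lemma open_conjz g n U : open U -> open [set y | U (conjz g n y)].
Proof. by move=> oU; apply: (open_comp _ oU) => y _; exact: conjz_continuous. Qed.

Lemma closed_mulr x U : closed U -> closed [set y | U (y * x)%g].
Proof.
move=> oU; apply: (closed_comp (f := fun y => (y * x)%g) _ oU) => y _.
exact: mulgr_continuous.
Qed.

Lemma closed_conjz g n U : closed U -> closed [set y | U (conjz g n y)].
Proof.
move=> oU; apply: (closed_comp (f := conjz g n) _ oU) => y _.
exact: conjz_continuous.
Qed.

(** A union of left cosets of an open subgroup is open, and so is its
complement, which is another such union. *)
Lemma open_union_coset H U : subgroup U -> open U ->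
  (forall x u, H x -> U u -> H (x * u)%g) -> open H.
Proof.
move=> sU oU HU; rewrite openE => x Hx; rewrite /interior.
have : nbhs x [set y | U (x^-1 * y)%g].
  apply: open_nbhs_nbhs; split; first exact: open_mull.
  by rewrite /= mulVg; exact: subgroup1.
by apply: filterS => y /= Uy; rewrite -(mulVKg x y); exact: HU.
Qed.

Lemma open_superset H U : subgroup H -> subgroup U -> open U -> U `<=` H -> open H.
Proof.
move=> sH sU oU UH; apply: (open_union_coset sU oU) => x u Hx Uu.
by apply: subgroupM => //; exact: UH.
Qed.

Lemma closed_union_coset H U : subgroup U -> open U ->
  (forall x u, H x -> U u -> H (x * u)%g) -> closed H.
Proof.
move=> sU oU HU; rewrite -openC; apply: (open_union_coset sU oU) => x u nHx Uu Hxu.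
by apply: nHx; rewrite -(mulgK u x); apply: HU => //; exact: subgroupV.
Qed.

Lemma open_subgroup_closed U : subgroup U -> open U -> closed U.
Proof.
by move=> sU oU; apply: (closed_union_coset sU oU) => x u Ux Uu; exact: subgroupM.
Qed.

Lemma compact_image_conjz g n U : compact U -> compact (conjz g n @` U).
Proof.
move=> cU; apply: continuous_compact => //; apply: continuous_subspaceT.
exact: conjz_continuous.
Qed.

Definition mulset H K : set G := [set x | exists h k, [/\ H h, K k & x = (h * k)%g]].

Lemma compact_mulset H K : compact H -> compact K -> compact (mulset H K).
Proof.
move=> cH cK.
have -> : mulset H K = (fun z : G * G => (z.1 * z.2)%g) @` (H `*` K).
  apply/seteqP; split=> x.
    by move=> [h [k [Hh Kk ->]]]; exists (h, k).
  by move=> [[h k] [/= Hh Kk] <-]; exists h, k.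
apply: continuous_compact; last exact: compact_setX.
by apply: continuous_subspaceT => x; exact: mulg_continuous.
Qed.

End TopologicalGroup.

(** * Contraction parts and subgroups tidy above *)
Section TidyAbove.
Context {G : topologicalGroupType}.
Implicit Types (g h x y : G) (H K U P O : set G).

(** In the usual notation for a subgroup P and the conjugation by g, these are
P_-, P_+, P_0 and P_--. *)
Definition forward g P : set G := [set h | forall n : nat, P (conjz g n h)].
Definition backward g P : set G := [set h | forall n : nat, P (conjz g (- n%:Z) h)].
Definition core g P : set G := [set h | forall n : int, P (conjz g n h)].
Definition eventual g P : set G :=
  [set h | exists N : nat, forall n : nat, (N <= n)%N -> P (conjz g n h)].

Definition tidy_above g P := forall h, P h ->
  exists a b, [/\ backward g P a, forward g P b & h = (a * b)%g].

Lemma backwardV g P : backward g^-1%g P = forward g P.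
Proof.
by apply/seteqP; split=> h + n => /(_ n); rewrite conjVz opprK.
Qed.

Lemma forwardV g P : forward g^-1%g P = backward g P.
Proof. by rewrite -backwardV invgK. Qed.

Lemma coreV g P : core g^-1%g P = core g P.
Proof.
by apply/seteqP; split=> h + n => /(_ (- n)); rewrite conjVz ?opprK.
Qed.

Lemma forward_ge0 g P h (z : int) : forward g P h -> 0 <= z -> P (conjz g z h).
Proof. by case: z => // n Ph _; exact: Ph. Qed.

Lemma backward_le0 g P h (z : int) : backward g P h -> z <= 0 -> P (conjz g z h).
Proof.
move=> Ph z0; have -> : z = - (absz z)%:Z by lia.
exact: Ph.
Qed.

Lemma forward_sub g P : forward g P `<=` P.
Proof. by move=> h /(_ 0%N); rewrite conjz0. Qed.

Lemma backward_sub g P : backward g P `<=` P.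
Proof. by rewrite -forwardV; exact: forward_sub. Qed.

Lemma core_forward g P : core g P `<=` forward g P.
Proof. by move=> h Ph n; exact: Ph. Qed.

Lemma core_backward g P : core g P `<=` backward g P.
Proof. by move=> h Ph n; exact: Ph. Qed.

Lemma core_sub g P : core g P `<=` P.
Proof. by move=> h /core_forward /forward_sub. Qed.

Lemma coreP g P h : backward g P h -> forward g P h -> core g P h.
Proof.
move=> bh fh n; have [n0|n0] := leP 0 n; first exact: forward_ge0.
by apply: backward_le0 => //; exact: ltW.
Qed.

Lemma forward_eventual g P : forward g P `<=` eventual g P.
Proof. by move=> h Ph; exists 0%N => n _; exact: Ph. Qed.

Lemma core_eventual g P : core g P `<=` eventual g P.
Proof. by move=> h /core_forward /forward_eventual. Qed.

Lemma forward_conjz g P h (z : int) : 0 <= z -> forward g P h -> forward g P (conjz g z h).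
Proof. by move=> z0 Ph n; rewrite -conjzD; apply: forward_ge0 => //; lia. Qed.

Lemma backward_conjz g P h (z : int) : z <= 0 -> backward g P h -> backward g P (conjz g z h).
Proof. by move=> z0 Ph n; rewrite -conjzD; apply: backward_le0 => //; lia. Qed.

Lemma core_conjz g P h (z : int) : core g P h -> core g P (conjz g z h).
Proof. by move=> Ph n; rewrite -conjzD; apply: Ph. Qed.

Lemma eventual_conjz g P h (z : int) : eventual g P h -> eventual g P (conjz g z h).
Proof.
move=> [N Ph]; exists (N + absz z)%N => n Nn; rewrite -conjzD.
have -> : n%:Z + z = absz (n%:Z + z) by lia.
by apply: Ph; lia.
Qed.

(** P_-- is the ascending union of the conjugates of P_- by negative powers. *)
Lemma eventualE g P h : eventual g P h <-> exists N : nat, forward g P (conjz g N h).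
Proof.
split=> -[N Ph]; exists N.
  by move=> n; rewrite -conjzD -PoszD; apply: Ph; lia.
move=> n Nn; have := Ph (n - N)%N; rewrite -conjzD.
by congr P; congr conjz; lia.
Qed.

Lemma forwardS g P O : P `<=` O -> forward g P `<=` forward g O.
Proof. by move=> PO h Ph n; exact: PO. Qed.
Lemma backwardS g P O : P `<=` O -> backward g P `<=` backward g O.
Proof. by move=> PO h Ph n; exact: PO. Qed.
Lemma coreS g P O : P `<=` O -> core g P `<=` core g O.
Proof. by move=> PO h Ph n; exact: PO. Qed.
Lemma eventualS g P O : P `<=` O -> eventual g P `<=` eventual g O.
Proof. by move=> PO h [N Ph]; exists N => n Nn; apply: PO; exact: Ph. Qed.

Lemma subgroup_forward g P : subgroup P -> subgroup (forward g P).
Proof.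
move=> sP; split=> [n|x y Px Py n]; first by rewrite conjz1; exact: subgroup1.
by rewrite conjzM conjzV; apply: sP.2.
Qed.

Lemma subgroup_backward g P : subgroup P -> subgroup (backward g P).
Proof. by rewrite -forwardV; exact: subgroup_forward. Qed.

Lemma subgroup_core g P : subgroup P -> subgroup (core g P).
Proof.
move=> sP; split=> [n|x y Px Py n]; first by rewrite conjz1; exact: subgroup1.
by rewrite conjzM conjzV; apply: sP.2.
Qed.

Lemma subgroup_eventual g P : subgroup P -> subgroup (eventual g P).
Proof.
move=> sP; split=> [|x y [N Px] [M Py]].
  by exists 0%N => n _; rewrite conjz1; exact: subgroup1.
exists (maxn N M) => n; rewrite geq_max => /andP[Nn Mn].
by rewrite conjzM conjzV; apply: sP.2; [exact: Px|exact: Py].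
Qed.

Lemma closed_forward g P : closed P -> closed (forward g P).
Proof.
move=> cP; have -> : forward g P = \bigcap_(n in [set: nat]) [set h | P (conjz g n h)].
  by apply/seteqP; split=> [h Ph n _|h Ph n]; exact: Ph.
by apply: closed_bigI => n _; exact: closed_conjz.
Qed.

Lemma closed_backward g P : closed P -> closed (backward g P).
Proof. by rewrite -forwardV; exact: closed_forward. Qed.

Lemma closed_core g P : closed P -> closed (core g P).
Proof.
move=> cP; have -> : core g P = \bigcap_(n in [set: int]) [set h | P (conjz g n h)].
  by apply/seteqP; split=> [h Ph n _|h Ph n]; exact: Ph.
by apply: closed_bigI => n _; exact: closed_conjz.
Qed.

Section CompactOpen.
Variable P : set G.
Hypothesis cP : compact_open_subgroup P.

Lemma co_subgroup : subgroup P. Proof. by case: cP. Qed.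
Lemma co_compact : compact P. Proof. by case: cP. Qed.
Lemma co_open : open P. Proof. by case: cP. Qed.
Lemma co_closed : closed P.
Proof. by case: cP => ? ? ?; exact: open_subgroup_closed. Qed.
End CompactOpen.

Lemma compact_forward g P : compact_open_subgroup P -> compact (forward g P).
Proof.
move=> cP; apply: (subclosed_compact _ (co_compact cP)); last exact: forward_sub.
exact: closed_forward (co_closed cP).
Qed.

Lemma compact_core g P : compact_open_subgroup P -> compact (core g P).
Proof.
move=> cP; apply: (subclosed_compact _ (co_compact cP)); last exact: core_sub.
exact: closed_core (co_closed cP).
Qed.

Lemma tidy_aboveV g P : subgroup P -> tidy_above g P -> tidy_above g^-1%g P.
Proof.
move=> sP tP h /(subgroupV sP) /tP [a [b [Pa Pb hab]]].
exists b^-1%g, a^-1%g; rewrite backwardV forwardV; split.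
- exact: subgroupV (subgroup_forward _ sP) Pb.
- exact: subgroupV (subgroup_backward _ sP) Pa.
- by rewrite -invgM -hab invgK.
Qed.

(** For fixed [p], the left factors [a] that leave a remainder staying in [P] up
to time [n] form a closed set; used to pass to the limit of factorizations. *)
Lemma closed_residual g P p (n : nat) : closed P ->
  closed [set a | forall i : nat, (i <= n)%N -> P (conjz g i (a^-1 * p)%g)].
Proof.
move=> clP.
have -> : [set a | forall i : nat, (i <= n)%N -> P (conjz g i (a^-1 * p)%g)] =
    \bigcap_(i in [set i | (i <= n)%N])
       [set a | P (conjz g (Posz i) (a^-1 * p)%g)] by [].
apply: closed_bigI => i _.
apply: (closed_comp (f := fun a : G => (a^-1)%g) (D := [set y | P (conjz g i (y * p)%g)])).
  by move=> y _; exact: invg_continuous.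
exact: (@closed_mulr _ p _ (@closed_conjz _ g i _ clP)).
Qed.

(** The hypothesis says that gPg^-1 is contained in (gP_+g^-1) P. It lets one
peel off factors of P_+ so that the remainder stays in [P] for one more step;
compactness of P_+ supplies a factor that works for all steps at once. *)
Lemma expansion_tidy_above g P : compact_open_subgroup P ->
  (forall x, P (conjz g (-1) x) ->
    exists a u, [/\ backward g P (conjz g (-1) a), P u & x = (a * u)%g]) ->
  tidy_above g P.
Proof.
move=> cP exP p Pp; have sP := co_subgroup cP.
pose A (n : nat) := backward g P `&`
  [set a | forall i : nat, (i <= n)%N -> P (conjz g i (a^-1 * p)%g)].
have clA n : closed (A n).
  apply: closedI; first exact: closed_backward (co_closed cP).
  exact: closed_residual (co_closed cP).
have [|||n|a Aa] := nested_compact_nonempty (A := A).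
- apply: (subclosed_compact (clA _) (co_compact cP)).
  by move=> a [/backward_sub].
- exact: clA.
- by move=> n a [Pa aP]; split=> // i /leqW; exact: aP.
- elim: n => [|n [a [Pa aP]]].
    exists 1%g; split; first exact: subgroup1 (subgroup_backward _ sP).
    by move=> i; rewrite leqn0 => /eqP ->; rewrite conjz0 invg1 mul1g.
  pose q := conjz g n (a^-1 * p)%g.
  have Pq : P q by exact: aP.
  have [|c [u [Pc Pu qcu]]] := exP (conjz g 1 q); first by rewrite conjzK.
  pose c' := conjz g (- n.+1%:Z) c.
  have Pc' : backward g P c'.
    have -> : c' = conjz g (- n%:Z) (conjz g (-1) c).
      by rewrite -conjzD /c'; congr conjz; lia.
    by apply: backward_conjz => //; lia.
  have cu : (c'^-1 * (a^-1 * p))%g = conjz g (- n.+1%:Z) u.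
    apply: (mulgI c'); rewrite mulVKg -conjzM -qcu /q -!conjzD conjz_id //.
    lia.
  exists (a * c')%g; split; first exact: subgroupM (subgroup_backward _ sP) _ _.
  move=> i; rewrite leq_eqVlt invgM -mulgA => /orP[/eqP ->|].
    by rewrite cu conjzKV.
  rewrite ltnS => le_in; rewrite conjzM conjzV; apply: subgroupM => //; last exact: aP.
  apply: subgroupV => //; rewrite /c' -conjzD.
  have -> : i%:Z - n.+1%:Z = (i%:Z - n%:Z) + (-1) by lia.
  by rewrite conjzD; apply: backward_le0 => //; lia.
- exists a, (a^-1 * p)%g; split; [exact: (Aa 0%N).1| |by rewrite mulVKg].
  by move=> n; exact: ((Aa n).2 n).
Qed.

Definition conj_cap g O (N : nat) : set G :=
  [set h | forall i : nat, (i <= N)%N -> O (conjz g (- i%:Z) h)].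

Lemma conj_cap_sub g O N : conj_cap g O N `<=` O.
Proof. by move=> h /(_ 0%N isT); rewrite conjz0. Qed.

Lemma backward_conj_cap g O N : backward g (conj_cap g O N) = backward g O.
Proof.
apply/seteqP; split; first exact: backwardS (@conj_cap_sub _ _ _).
by move=> h Oh n i _; rewrite -conjzD; apply: backward_le0 => //; lia.
Qed.

Lemma co_conj_cap g O N : compact_open_subgroup O -> compact_open_subgroup (conj_cap g O N).
Proof.
move=> cO; have sO := co_subgroup cO.
have sC : subgroup (conj_cap g O N).
  split=> [i _|x y Ox Oy i iN]; first by rewrite conjz1; exact: subgroup1.
  by rewrite conjzM conjzV; apply: sO.2; [exact: Ox|exact: Oy].
have oC : open (conj_cap g O N).
  elim: N {sC} => [|N IH].
    have -> : conj_cap g O 0 = O.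
      apply/seteqP; split; first exact: conj_cap_sub.
      by move=> h Oh i; rewrite leqn0 => /eqP ->; rewrite conjz0.
    exact: co_open.
  have -> : conj_cap g O N.+1 = conj_cap g O N `&` [set h | O (conjz g (- N.+1%:Z) h)].
    apply/seteqP; split=> [h Oh|h [Oh ON] i].
      by split=> [i iN|]; apply: Oh => //; exact: leqW.
    by rewrite leq_eqVlt => /orP[/eqP -> //|]; exact: Oh.
  by apply: openI => //; apply: open_conjz; exact: co_open.
split=> //; apply: (subclosed_compact _ (co_compact cO)); last exact: conj_cap_sub.
exact: open_subgroup_closed.
Qed.

(** The sets g O_n g^-1, with O_n the intersection of the first n + 1 conjugates
of [O], decrease to g O_+ g^-1, which is inside the open set (g O_+ g^-1) O. By
compactness some g O_N g^-1 is already inside, and this is the criterion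
[expansion_tidy_above] for O_N, as O_N and O have the same part O_+. *)
Lemma tidy_above_conj_cap g O : compact_open_subgroup O ->
  exists N, tidy_above g (conj_cap g O N).
Proof.
move=> cO; have sO := co_subgroup cO.
pose A n : set G := [set x | conj_cap g O n (conjz g (-1) x)].
pose W : set G :=
  [set x | exists a u, [/\ backward g O (conjz g (-1) a), O u & x = (a * u)%g]].
have clA n : closed (A n) by apply: closed_conjz; exact: co_closed (co_conj_cap _ _ cO).
have [||||N AW] := nested_compact_sub (A := A) (O := W) _ clA.
- have -> : A 0%N = conjz g 1 @` (conj_cap g O 0).
    apply/seteqP; split=> x.
      by exists (conjz g (-1) x) => //; rewrite conjzKV.
    by move=> [y Oy <-]; rewrite /A /= conjzK.
  exact: compact_image_conjz (co_compact (co_conj_cap _ _ cO)).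
- by move=> n x Ax i /leqW; exact: Ax.
- apply: (open_union_coset sO (co_open cO)) => x u [a [v [Oa Ov ->]]] Ou.
  by exists a, (v * u)%g; split=> //; [exact: subgroupM|rewrite mulgA].
- move=> x Ax; exists x, 1%g; split; [|exact: subgroup1|by rewrite mulg1].
  by move=> n; exact: (Ax n I n).
exists N; apply: expansion_tidy_above; first exact: co_conj_cap.
move=> x Cx; have [a [u [Oa Ou xau]]] := AW x Cx.
exists a, u; rewrite backward_conj_cap; split=> // i.
case: i => [_|i iN]; first by rewrite conjz0.
have -> : - i.+1%:Z = - i%:Z + (-1) by lia.
have -> : u = (a^-1 * x)%g by rewrite xau mulKg.
rewrite conjzD !conjzM !conjzV; apply: subgroupM => //; last exact: (Cx i (ltnW iN)).
by apply: subgroupV => //; exact: Oa.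
Qed.

(** The forward conjugates of P_- shrink to P_0, so that one of them is inside
Q P_0. Writing Q as Q_- Q_+, the factor from Q_+ lies in P_- as well as in P_+,
so in P_0 and can be absorbed. *)
Lemma eventual_decomposition g P Q :
  compact_open_subgroup P -> compact_open_subgroup Q -> Q `<=` P ->
  tidy_above g Q -> eventual g P `<=` mulset (eventual g Q) (core g P).
Proof.
move=> cP cQ QP tQ h /eventualE [M Ph].
have sP := co_subgroup cP; have sQ := co_subgroup cQ.
pose A (n : nat) : set G := [set x | forward g P (conjz g (- n%:Z) x)].
pose W : set G := [set x | exists q l, [/\ core g P l, Q q & x = (l * q)%g]].
have [|||||n AW] := nested_compact_sub (A := A) (O := W).
- have -> : A 0%N = forward g P by apply/seteqP; split=> x; rewrite /A /= conjz0.
  exact: compact_forward.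
- by move=> n; apply: closed_conjz; exact: closed_forward (co_closed cP).
- move=> n x Ax; rewrite /A /=.
  have -> : - n%:Z = 1 + (- n.+1%:Z) by lia.
  by rewrite conjzD; exact: forward_conjz.
- apply: (open_union_coset sQ (co_open cQ)) => x u [q [l [Pl Qq ->]]] Qu.
  by exists (q * u)%g, l; split=> //; [exact: subgroupM|rewrite mulgA].
- move=> x Ax; exists 1%g, x; split; [|exact: subgroup1|by rewrite mulg1].
  apply: coreP => [n|n].
    by have := Ax n I 0%N; rewrite conjz0.
  by have := Ax 0%N I n; rewrite conjz0.
have [|q [l [Pl Qq hlq]]] := AW (conjz g n (conjz g M h))^-1%g.
  rewrite /A /= conjzV conjzK; exact: subgroupV (subgroup_forward _ sP) Ph.
(* The factor [a] from Q_+ also belongs to the core of [P]. *)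
have [a [b [Qa Qb qab]]] := tQ _ Qq.
have hE : conjz g n (conjz g M h) = (b^-1 * (a^-1 * l^-1))%g.
  by rewrite -invgM -invgM -mulgA -qab -hlq invgK.
have Pa : core g P a.
  apply: coreP; first exact: backwardS Qa.
  have -> : a = (l^-1 * (conjz g n (conjz g M h))^-1 * b^-1)%g.
    by rewrite hE !invgM !invgK !mulgA mulgK mulVg mul1g.
  have sF := subgroup_forward g sP.
  have fl : forward g P l^-1%g := subgroupV sF (core_forward Pl).
  have fh : forward g P (conjz g n (conjz g M h))^-1%g.
    exact: (subgroupV sF (forward_conjz _ Ph)).
  exact: (sF.2 _ _ (subgroupM sF fl fh) (forwardS QP Qb)).
pose z : int := - (n%:Z + M%:Z).
have hz : h = conjz g z (conjz g n (conjz g M h)).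
  by rewrite -!conjzD conjz_id // /z; lia.
exists (conjz g z b^-1)%g, (conjz g z (a^-1 * l^-1))%g; split.
- apply/eventual_conjz/forward_eventual; exact: subgroupV (subgroup_forward _ sQ) Qb.
- have sC := subgroup_core g sP.
  exact: (core_conjz _ (sC.2 _ _ (subgroupV sC Pa) Pl)).
- by rewrite hz hE conjzM.
Qed.

End TidyAbove.

(** * Counting cosets *)
Section Counting.
Context {G : topologicalGroupType}.
Implicit Types (g h x y : G) (D E H U P X Y : set G).

Definition covers (T : finType) (t : T -> G) X D :=
  forall x, X x -> exists i, D ((t i)^-1 * x)%g.

Definition separated (T : finType) (t : T -> G) X D :=
  (forall i, X (t i)) /\ forall i j, D ((t i)^-1 * t j)%g -> i = j.

(** Bounds on the number of left cosets of [D] that meet [X]; for [X] a group it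
is the index of the intersection with [D]. Upper bounds come from covering
families, whose members may lie outside [X], and lower bounds from families of
inequivalent elements of [X]; both kinds multiply along chains, so that growth
rates can be compared without cardinal arithmetic. *)
Definition index_le X D n := exists (T : finType) (t : T -> G), #|T| = n /\ covers t X D.
Definition index_ge X D n := exists (T : finType) (t : T -> G), #|T| = n /\ separated t X D.
Definition index_eq X D n := exists (T : finType) (t : T -> G),
  [/\ #|T| = n, separated t X D & covers t X D].

Lemma index_eq_le X D n : index_eq X D n -> index_le X D n.
Proof. by move=> [T [t [Tn _ tc]]]; exists T, t. Qed.

Lemma index_eq_ge X D n : index_eq X D n -> index_ge X D n.
Proof. by move=> [T [t [Tn ts _]]]; exists T, t. Qed.

Lemma same_coset D x y z : subgroup D -> D (x^-1 * y)%g -> D (x^-1 * z)%g ->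
  D (y^-1 * z)%g.
Proof.
move=> sD Dxy Dxz; have := subgroupM sD (subgroupV sD Dxy) Dxz.
by rewrite invgM invgK mulgA mulgK.
Qed.

Lemma index_ge_le X D m n : subgroup D -> index_ge X D m -> index_le X D n -> (m <= n)%N.
Proof.
move=> sD [T [t [<- [tX tD]]]] [S [s [<- sc]]].
have /choice[f fP] : forall i : T, exists j : S, D ((s j)^-1 * t i)%g.
  by move=> i; exact: sc.
apply: (@leq_card _ _ f) => i j fij; apply: tD.
by apply: (same_coset sD (fP i)); rewrite fij.
Qed.

Lemma index_le_mul X D E a b : index_le X E a -> index_le E D b -> index_le X D (a * b).
Proof.
move=> [T [t [<- tc]]] [S [s [<- sc]]].
exists (T * S)%type, (fun p => t p.1 * s p.2)%g; rewrite card_prod; split=> // x Xx.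
have [i Ei] := tc x Xx; have [j Dj] := sc _ Ei.
by exists (i, j); rewrite /= invgM -mulgA.
Qed.

Lemma index_ge_mul X D E a b : subgroup X -> subgroup E -> E `<=` X -> D `<=` E ->
  index_ge X E a -> index_ge E D b -> index_ge X D (a * b).
Proof.
move=> sX sE EX DE [T [t [<- [tX tE]]]] [S [s [<- [sEs sD]]]].
exists (T * S)%type, (fun p => t p.1 * s p.2)%g; rewrite card_prod; split=> //; split.
  by move=> p; apply: subgroupM => //; exact: EX.
move=> [i j] [i' j'] /=; rewrite invgM -mulgA => Dij.
have ii' : i = i'.
  apply: tE; rewrite mulgA in Dij.
  have := subgroupM sE (subgroupM sE (sEs j) (DE _ Dij)) (subgroupV sE (sEs j')).
  by rewrite !mulgA mulgV mul1g mulgK.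
subst i'; congr pair; apply: sD; move: Dij.
by rewrite [((t i)^-1 * _)%g]mulgA mulVg mul1g.
Qed.

Lemma index_le_sub X Y D E n : Y `<=` X -> D `<=` E -> index_le X D n -> index_le Y E n.
Proof.
move=> YX DE [T [t [Tn tc]]]; exists T, t; split=> // x /YX /tc [i Di].
by exists i; exact: DE.
Qed.

Lemma index_ge_sub X Y D E n : X `<=` Y -> E `<=` D -> index_ge X D n -> index_ge Y E n.
Proof.
move=> XY ED [T [t [Tn [tX tD]]]]; exists T, t; split=> //; split.
  by move=> i; exact: XY.
by move=> i j /ED; exact: tD.
Qed.

Lemma index_ge_meet X D n : subgroup X -> index_ge X (X `&` D) n -> index_ge X D n.
Proof.
move=> sX [T [t [Tn [tX tD]]]]; exists T, t; split=> //; split=> // i j Dij.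
by apply: tD; split=> //; apply: subgroupM => //; exact: subgroupV.
Qed.

Lemma index_le_conjz g z X D n : index_le X D n ->
  index_le [set x | X (conjz g z x)] [set x | D (conjz g z x)] n.
Proof.
move=> [T [t [Tn tc]]]; exists T, (fun i => conjz g (- z) (t i)); split=> // x /= Xx.
have [i Di] := tc _ Xx; exists i.
by rewrite conjzM -conjzV conjzKV.
Qed.

Lemma index_ge_conjz g z X D n : index_ge X D n ->
  index_ge [set x | X (conjz g z x)] [set x | D (conjz g z x)] n.
Proof.
move=> [T [t [Tn [tX tD]]]]; exists T, (fun i => conjz g (- z) (t i)); split=> //.
split=> [i|i j] /=; first by rewrite conjzKV.
by rewrite conjzM -conjzV !conjzKV; exact: tD.
Qed.

Lemma index_le_compact X D : compact X -> subgroup D -> open D -> exists n, index_le X D n.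
Proof.
move=> cX sD oD.
have [x Xx|D' XD'] := compact_finite_cover (U := fun y => [set x | D (y^-1 * x)%g]) cX.
  apply: open_nbhs_nbhs; split; first exact: open_mull.
  by rewrite /= mulVg; exact: subgroup1.
exists #|{: D'}|, D', val; split=> // x /XD' [y yD' /= Dyx].
by exists [` yD']%fset.
Qed.

(** A separated family of maximal size covers: a point missed by it could be
added. *)
Lemma index_eq_exists X D n : subgroup D -> index_le X D n -> exists m, index_eq X D m.
Proof.
move=> sD Xn.
have ex : exists m, `[< index_ge X D m >].
  by exists 0%N; apply/asboolP; exists 'I_0, (fun=> 1%g); rewrite card_ord; split=> //;
    split; case.
have bnd m : `[< index_ge X D m >] -> (m <= n)%N.
  by move=> /asboolP Xm; exact: index_ge_le Xn.
case: (ex_maxnP ex bnd) => m /asboolP[T [t [Tm [tX tD]]]] max.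
exists m, T, t; split=> // x Xx; apply: contrapT => /forallNP nx.
have : (m.+1 <= m)%N; last by rewrite ltnn.
apply: max; apply/asboolP.
exists (option T), (fun o => if o is Some i then t i else x).
rewrite card_option Tm; split=> //; split=> [[i|]|[i|] [j|]] //.
- by move=> Dij; congr Some; exact: tD.
- by move=> /nx.
- by move=> Dji; case: (nx j); have := subgroupV sD Dji; rewrite invgM invgK.
Qed.

Lemma separated_covers X D n (T : finType) (t : T -> G) : subgroup D -> index_le X D n ->
  #|T| = n -> separated t X D -> covers t X D.
Proof.
move=> sD Xn Tn [tX tD] x Xx; apply: contrapT => /forallNP nx.
have : index_ge X D n.+1.
  exists (option T), (fun o => if o is Some i then t i else x).
  rewrite card_option Tn; split=> //; split=> [[i|]|[i|] [j|]] //.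
  - by move=> Dij; congr Some; exact: tD.
  - by move=> /nx.
  - by move=> Dji; case: (nx j); have := subgroupV sD Dji; rewrite invgM invgK.
by move=> /(index_ge_le sD)/(_ Xn); rewrite ltnn.
Qed.

Lemma left_cosets_card X D n : subgroup X -> subgroup D -> index_eq X D n ->
  (left_cosets X (D `&` X) #= `I_n)%card.
Proof.
move=> sX sD [T [t [<- [tX tD] tc]]].
have sDX := subgroupI sD sX.
pose F (i : 'I_#|T|) := left_coset (t (enum_val i)) (D `&` X).
have cosE x y : (D `&` X) (x^-1 * y)%g ->
    left_coset x (D `&` X) = left_coset y (D `&` X).
  move=> DXxy; apply/seteqP; split=> z [k Dk <-].
    exists (y^-1 * (x * k))%g; last by rewrite mulVKg.
    by rewrite mulgA; apply: subgroupM => //; have := subgroupV sDX DXxy; rewrite invgM invgK.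
  by exists (x^-1 * (y * k))%g; [rewrite mulgA; exact: subgroupM|rewrite mulVKg].
have -> : left_cosets X (D `&` X) = F @` setT.
  apply/seteqP; split=> S.
    move=> [x Xx <-]; have [i Di] := tc x Xx.
    exists (enum_rank i) => //; rewrite /F enum_rankK; apply: cosE; split=> //.
    by apply: subgroupM => //; exact: subgroupV.
  by move=> [i _ <-]; exists (t (enum_val i)).
rewrite (card_eql _ (B := [set: 'I_#|T|])); first by rewrite card_eq_sym card_II.
apply: inj_card_eq => i j _ _ Fij; apply: enum_val_inj; apply: tD.
have : F j (t (enum_val j)) by exists 1%g; [exact: subgroup1|rewrite mulg1].
by rewrite -Fij => -[k [Dk _] <-]; rewrite mulKg.
Qed.

Lemma conj_setE g X : conj_set g X = [set x | X (conjz g (-1) x)].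
Proof.
apply/seteqP; split=> x.
  by move=> [h Xh <-]; rewrite /= conjz_def /= expg1 invgK mulgA !mulgA mulVg mul1g mulgVK.
move=> /= Xx; exists (conjz g (-1) x) => //.
by rewrite -{2}(conjzKV g 1 x) [in RHS]conjz_def /= expg1.
Qed.

Lemma subgroup_conjz g z X : subgroup X -> subgroup [set x | X (conjz g z x)].
Proof.
move=> sX; split=> [|x y] /=; first by rewrite conjz1; exact: subgroup1.
by rewrite conjzM conjzV; exact: sX.2.
Qed.

Lemma compact_conjz g z X : compact X -> compact [set x | X (conjz g z x)].
Proof.
have -> : [set x | X (conjz g z x)] = conjz g (- z) @` X.
  apply/seteqP; split=> x; first by move=> /= Xx; exists (conjz g z x) => //; rewrite conjzK.
  by move=> [y Xy <-]; rewrite /= conjzKV.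
exact: compact_image_conjz.
Qed.

(** The index whose minimum over compact open [U] is the scale of [g]. *)
Definition conj_index g U n := index_eq [set x | U (conjz g (-1) x)] U n.

Lemma conj_index_exists g U : compact_open_subgroup U -> exists n, conj_index g U n.
Proof.
move=> cU; have [n Un] := index_le_compact (compact_conjz (g := g) (z := -1) (co_compact cU))
  (co_subgroup cU) (co_open cU).
exact: index_eq_exists (co_subgroup cU) Un.
Qed.

Lemma minimizing_conj_index g U V m n : compact_open_subgroup U -> compact_open_subgroup V ->
  conj_index g U m -> conj_index g V n ->
  (left_cosets (conj_set g U) (U `&` conj_set g U) #<=
   left_cosets (conj_set g V) (V `&` conj_set g V))%card = (m <= n)%N.
Proof.
move=> cU cV Um Vn; rewrite !conj_setE.
have sU := co_subgroup cU; have sV := co_subgroup cV.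
have Uc := left_cosets_card (subgroup_conjz g (-1) sU) sU Um.
have Vc := left_cosets_card (subgroup_conjz g (-1) sV) sV Vn.
by rewrite (card_le_eql Uc) (card_le_eqr Vc) card_le_II.
Qed.

End Counting.

(** * Growth of indices under iterated conjugation *)
Section Growth.
Context {G : topologicalGroupType}.
Implicit Types (g h x y : G) (D E H U V P X Y : set G).

Definition conjpre g (z : int) X : set G := [set x | X (conjz g z x)].

(** Given [tidy_above], this is equivalent to the closedness of the union of the
conjugates of P_-, the usual second condition of tidiness. *)
Definition tidy_below g P := forall h, backward g P h -> eventual g P h -> forward g P h.

(** Removing the P_- factor of [h] reduces to an element of P_+. *)
Lemma tidy_below_eventual g P h : subgroup P -> tidy_above g P -> tidy_below g P ->
  P h -> eventual g P h -> forward g P h.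
Proof.
move=> sP tA tB /tA [a [b [Pa Pb hab]]] Ph.
have sF := subgroup_forward g sP.
suff Ea : eventual g P a by rewrite hab; exact: (subgroupM sF (tB _ Pa Ea) Pb).
have -> : a = (h * b^-1)%g by rewrite hab mulgK.
exact: ((subgroup_eventual g sP).2 _ _ Ph (forward_eventual Pb)).
Qed.

(** The inverse of [h] has a P_- factor which, conjugated back by g^-n, falls in
P_+ and in P_--, hence in P_0, which conjugation preserves. *)
Lemma tidy_below_backward g P h (n : nat) : subgroup P -> tidy_above g P ->
  tidy_below g P -> P h -> backward g P (conjz g (- n%:Z) h) -> backward g P h.
Proof.
move=> sP tA tB Ph Pn; have sB := subgroup_backward g sP.
have [a [b [Pa Pb hab]]] := tA _ (subgroupV sP Ph).
have hE : h = (b^-1 * a^-1)%g by rewrite -invgM -hab invgK.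
rewrite hE; apply: (subgroupM sB); last exact: (subgroupV sB Pa).
have bE : (b^-1)%g = (h * a)%g by rewrite hE mulgVK.
have Pb' : forward g P b^-1%g := subgroupV (subgroup_forward g sP) Pb.
have c : core g P (conjz g (- n%:Z) b^-1%g).
  have Pb1 : backward g P (conjz g (- n%:Z) b^-1%g).
    rewrite bE conjzM; apply: (subgroupM sB) => //; apply: backward_conjz => //; lia.
  exact: (coreP Pb1 (tB _ Pb1 (eventual_conjz _ (forward_eventual Pb')))).
by have := core_conjz n c; rewrite conjzKV => /core_backward.
Qed.

(** P_+ and P_-- are both stable under conjugation by negative powers of [g]: a
bound valid for all elements can be applied to g^-N h g^N. *)
Lemma uniform_tidy_below g P (N : nat) :
  (forall h, backward g P h -> eventual g P h ->
     forall n : nat, (N <= n)%N -> P (conjz g n h)) ->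
  tidy_below g P.
Proof.
move=> PN h Ph Eh n.
have := PN (conjz g (- N%:Z) h) _ (eventual_conjz _ Eh) (N + n)%N (leq_addr _ _).
rewrite -conjzD; have -> : (N + n)%N%:Z - N%:Z = n%:Z by lia.
by apply; apply: backward_conjz => //; lia.
Qed.

Lemma conjpre_backward_meet g U h : U h -> backward g U (conjz g (-1) h) -> backward g U h.
Proof.
move=> Uh Ph [|m]; first by rewrite conjz0.
by have -> : - m.+1%:Z = - m%:Z + (-1) by [lia]; rewrite conjzD.
Qed.

Lemma tidy_above_conjpre g U x (n : nat) : tidy_above g U -> U (conjz g (- n%:Z) x) ->
  exists a b, [/\ backward g U (conjz g (- n%:Z) a), U b & x = (a * b)%g].
Proof.
move=> tU /tU [a [b [Ua Ub xab]]]; exists (conjz g n a), (conjz g n b); split.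
- by rewrite conjzK.
- exact: Ub.
- by rewrite -conjzM -xab conjzKV.
Qed.

Lemma conjpre_backwardS g U (m n : nat) : (m <= n)%N ->
  conjpre g (- m%:Z) (backward g U) `<=` conjpre g (- n%:Z) (backward g U).
Proof.
move=> mn h Uh; rewrite /conjpre /=.
have -> : - n%:Z = - (n - m)%N%:Z + - m%:Z by lia.
by rewrite conjzD; apply: backward_conjz => //; lia.
Qed.

Lemma conjpreD g m n X : conjpre g m (conjpre g n X) = conjpre g (n + m) X.
Proof. by apply/seteqP; split=> h; rewrite /conjpre /= conjzD. Qed.

(** For [U] tidy above, every coset of [U] in gUg^-1 has a representative in
g U_+ g^-1, and there [U] and U_+ cut out the same cosets. *)
Lemma conj_index_backward g U n : subgroup U -> tidy_above g U -> conj_index g U n ->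
  index_eq (conjpre g (-1) (backward g U)) (backward g U) n.
Proof.
move=> sU tU [T [t [Tn [tX tD] tc]]].
have /choice[a aP] : forall i, exists a, backward g U (conjz g (-1) a) /\ U (a^-1 * t i)%g.
  move=> i; have [a [b [Ua Ub ->]]] := tidy_above_conjpre (n := 1) tU (tX i).
  by exists a; rewrite mulKg.
exists T, a; split=> //; first split.
- by move=> i; exact: (aP i).1.
- move=> i j /backward_sub Uij; apply: tD.
  have := subgroupM sU (subgroupM sU (subgroupV sU (aP i).2) Uij) (aP j).2.
  by rewrite invgM invgK !mulgA !mulgK.
- move=> x Ux; have [i Ui] := tc x (backward_sub Ux); exists i.
  have sB := subgroup_backward g sU.
  have Uax : U ((a i)^-1 * x)%g.
    by have := subgroupM sU (aP i).2 Ui; rewrite !mulgA mulgK.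
  apply: (conjpre_backward_meet Uax); rewrite conjzM conjzV.
  exact: (subgroupM sB (subgroupV sB (aP i).1) Ux).
Qed.

Lemma backward_index_ge g U n : subgroup U ->
  index_ge (conjpre g (-1) (backward g U)) (backward g U) n ->
  index_ge (conjpre g (-1) (backward g U)) U n.
Proof.
move=> sU Un; have sB := subgroup_conjz g (-1) (subgroup_backward g sU).
apply: index_ge_meet => //; apply: index_ge_sub Un => // h [Uh Uh'].
exact: (conjpre_backward_meet Uh' Uh).
Qed.

Lemma conjpreS g z X Y : X `<=` Y -> conjpre g z X `<=` conjpre g z Y.
Proof. by move=> XY h; exact: XY. Qed.

Lemma conjpre_backward_index_ge g U n (k : nat) : subgroup U ->
  index_ge (conjpre g (-1) (backward g U)) (backward g U) n ->
  index_ge (conjpre g (- k%:Z) (backward g U)) (backward g U) (n ^ k).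
Proof.
move=> sU Un; have sB := subgroup_backward g sU.
elim: k => [|k IH].
  exists unit, (fun=> 1%g); rewrite card_unit; split=> //; split.
    by move=> _; rewrite /conjpre /= conjz1; exact: subgroup1 sB.
  by move=> [] [].
rewrite expnS; apply: index_ge_mul (IH).
- exact: (subgroup_conjz g (- k.+1%:Z) sB).
- exact: (subgroup_conjz g (- k%:Z) sB).
- exact: conjpre_backwardS.
- by move=> h Uh; apply: (conjpre_backwardS (leq0n k)); rewrite /conjpre /= conjz_id.
- have := index_ge_conjz g (- k%:Z) Un; rewrite -/(conjpre _ _ _) -/(conjpre _ _ _).
  by rewrite conjpreD; have -> : -1 + - k%:Z = - k.+1%:Z by lia.
Qed.

Lemma conjpre_backward_index_le g U n (k : nat) : subgroup U ->
  index_le (conjpre g (-1) (backward g U)) (backward g U) n ->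
  index_le (conjpre g (- k%:Z) (backward g U)) (backward g U) (n ^ k).
Proof.
move=> sU Un; have sB := subgroup_backward g sU.
elim: k => [|k IH].
  exists unit, (fun=> 1%g); rewrite card_unit; split=> // x.
  by rewrite /conjpre /= conjz0 => Ux; exists tt; rewrite invg1 mul1g.
rewrite expnS; apply: index_le_mul (IH).
have := index_le_conjz g (- k%:Z) Un; rewrite -/(conjpre _ _ _) -/(conjpre _ _ _).
by rewrite conjpreD; have -> : -1 + - k%:Z = - k.+1%:Z by lia.
Qed.

(** Tidiness makes the conjugation index of the k-th power as large as the
chain of conjugates of V_+ allows, since [V] meets them only in V_+. *)
Lemma tidy_growth g V v (k : nat) : subgroup V -> tidy_above g V -> tidy_below g V ->
  conj_index g V v -> index_ge (conjpre g (- k%:Z) V) V (v ^ k).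
Proof.
move=> sV tA tB /(conj_index_backward sV tA) /index_eq_ge /(conjpre_backward_index_ge k sV) Vk.
have sB := subgroup_conjz g (- k%:Z) (subgroup_backward g sV).
apply: (@index_ge_sub _ (conjpre g (- k%:Z) (backward g V)) _ V V) => //.
  by apply: conjpreS; exact: backward_sub.
apply: index_ge_meet => //; apply: index_ge_sub Vk => // h [hk Vh].
exact: tidy_below_backward hk.
Qed.

(** The part of the k-th conjugate of U_+ lost when counting cosets of [U]
instead of cosets of U_+; it equals U_+ for all k when [U] is tidy. *)
Definition overlap g U (k : nat) := U `&` conjpre g (- k%:Z) (backward g U).

Lemma subgroup_overlap g U k : subgroup U -> subgroup (overlap g U k).
Proof.
move=> sU; apply: subgroupI => //; exact: (subgroup_conjz g (- k%:Z) (subgroup_backward g sU)).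
Qed.

Lemma backward_overlap g U k : backward g U `<=` overlap g U k.
Proof.
move=> h Uh; split; first exact: backward_sub Uh.
by rewrite /conjpre /=; apply: backward_conjz => //; lia.
Qed.

Lemma tidy_above_growth g U u (k : nat) s : subgroup U -> tidy_above g U ->
  conj_index g U u -> index_ge (overlap g U k) (backward g U) s ->
  exists2 a, index_le (conjpre g (- k%:Z) U) U a & (a * s <= u ^ k)%N.
Proof.
move=> sU tU /(conj_index_backward sU tU) Uu Us.
have Uk := conjpre_backward_index_le k sU (index_eq_le Uu).
have sB := subgroup_backward g sU; have sBk := subgroup_conjz g (- k%:Z) sB.
have [a [T [t [Ta [tX tD] tc]]]] : exists a, index_eq (conjpre g (- k%:Z) (backward g U)) U a.
  apply: (index_eq_exists (n := u ^ k)) => //; apply: index_le_sub Uk => //.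
  exact: backward_sub.
exists a.
  exists T, t; split=> // x /(tidy_above_conjpre tU) [b [c [Ub Uc ->]]].
  by have [i Ui] := tc b Ub; exists i; rewrite mulgA; exact: subgroupM.
apply: (index_ge_le sB _ Uk).
apply: (index_ge_mul (E := overlap g U k)) => //.
- exact: subgroup_overlap.
- by move=> h [].
- exact: backward_overlap.
- by exists T, t; split=> //; split=> // i j [/tD].
Qed.

(** The constant [c] compares [U] with [V] and [V] with [U]; conjugation by a
power of [g] does not change these two indices. *)
Lemma growth_comparison g V v U u : compact_open_subgroup V ->
  tidy_above g V -> tidy_below g V -> conj_index g V v ->
  compact_open_subgroup U -> tidy_above g U -> conj_index g U u ->
  exists c, forall k s, index_ge (overlap g U k) (backward g U) s ->
    (v ^ k * s <= c * u ^ k)%N.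
Proof.
move=> cV tA tB Vv cU tU Uu.
have sV := co_subgroup cV; have sU := co_subgroup cU.
have [c1 VU] := index_le_compact (co_compact cV) sU (co_open cU).
have [c2 UV] := index_le_compact (co_compact cU) sV (co_open cV).
exists (c1 * c2)%N => k s Us.
have [a Ua le_as] := tidy_above_growth sU tU Uu Us.
have Vk := tidy_growth k sV tA tB Vv.
have := index_ge_le sV Vk (index_le_mul (index_le_mul (index_le_conjz g (- k%:Z) VU) Ua) UV).
move=> le_v; apply: (@leq_trans (c1 * a * c2 * s)); first by rewrite leq_mul2r le_v orbT.
by rewrite -!mulnA leq_mul2l mulnC -mulnA leq_mul2l (mulnC s) le_as !orbT.
Qed.

Lemma conj_index_gt0 g U u : subgroup U -> conj_index g U u -> (0 < u)%N.
Proof.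
move=> sU [T [t [<- _ tc]]]; have [|i _] := tc 1%g; last by apply/card_gt0P; exists i.
by rewrite /= conjz1; exact: subgroup1.
Qed.

(** If u < v then v^k is at least u^k + k u^(k-1), by Bernoulli's inequality. *)
Lemma expn_dominated (u v c : nat) : (0 < u)%N ->
  (forall k, v ^ k <= c * u ^ k)%N -> (v <= u)%N.
Proof.
move=> u0 vu; rewrite leqNgt; apply/negP => uv.
have bern k : (u ^ k + k * u ^ k.-1 <= u.+1 ^ k)%N.
  elim: k => [|k IH] //=; rewrite expnS.
  have := leq_mul (leqnn u.+1) IH; rewrite -expnS; apply: leq_trans.
  case: k {IH} => [|k] /=; first by rewrite !expn0; lia.
  by rewrite !expnS; nia.
pose k := (c * u)%N.
have uvk : (u.+1 ^ k.+1 <= v ^ k.+1)%N by rewrite leq_exp2r.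
have := leq_trans (leq_trans (bern k.+1) uvk) (vu k.+1).
rewrite /= [in X in (_ <= X)%N]expnS expnS; have : (0 < u ^ k)%N by rewrite expn_gt0 u0.
by rewrite /k; nia.
Qed.

End Growth.

(** * Minimizing subgroups are the tidy ones *)
Section Minimizing.
Context {G : topologicalGroupType}.
Implicit Types (g h x y : G) (D E H U V P W X Y : set G).

Lemma conj_cap_index_ge g W N u : compact_open_subgroup W -> tidy_above g (conj_cap g W N) ->
  conj_index g (conj_cap g W N) u -> index_ge (conjpre g (-1) (backward g W)) W u.
Proof.
move=> cW tP Pu; have sW := co_subgroup cW.
have := index_eq_ge (conj_index_backward (co_subgroup (co_conj_cap g N cW)) tP Pu).
by rewrite backward_conj_cap => /(backward_index_ge sW).
Qed.

(** Passing to a finite intersection that is tidy above does not increase the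
index: it becomes that of W_+ in g W_+ g^-1, and [W] meets g W_+ g^-1 in W_+. *)
Lemma conj_cap_index_le g W N u w : compact_open_subgroup W -> tidy_above g (conj_cap g W N) ->
  conj_index g (conj_cap g W N) u -> conj_index g W w -> (u <= w)%N.
Proof.
move=> cW tP Pu Ww; have sW := co_subgroup cW.
apply: (index_ge_le sW _ (index_eq_le Ww)).
apply: index_ge_sub (conj_cap_index_ge cW tP Pu) => //; apply: conjpreS.
exact: backward_sub.
Qed.

Lemma tidy_minimizing g V : compact_open_subgroup V -> tidy_above g V ->
  tidy_below g V -> minimizing g V.
Proof.
move=> cV tA tB; split=> // W cW.
have [v Vv] := conj_index_exists g cV; have [w Ww] := conj_index_exists g cW.
rewrite (minimizing_conj_index cV cW Vv Ww).
have [N tP] := tidy_above_conj_cap g cW; have cP := co_conj_cap g N cW.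
have [u Pu] := conj_index_exists g cP.
apply: leq_trans (conj_cap_index_le cW tP Pu Ww).
have sP := co_subgroup cP.
have [c vuc] := growth_comparison cV tA tB Vv cP tP Pu.
apply: (expn_dominated (conj_index_gt0 sP Pu)) => k.
have := vuc k 1%N; rewrite muln1; apply.
exists unit, (fun=> 1%g); rewrite card_unit; split=> //; split=> [_|[] []] //.
exact: (subgroup1 (subgroup_overlap g k sP)).
Qed.

(** Minimality gives equality in [conj_cap_index_le], so that representatives in
g U_+ g^-1 already cover gUg^-1. *)
Lemma minimizing_tidy_above g U : minimizing g U -> tidy_above g U.
Proof.
move=> [cU minU]; have sU := co_subgroup cU.
have [w Uw] := conj_index_exists g cU.
have [N tP] := tidy_above_conj_cap g cU; have cP := co_conj_cap g N cU.
have [u Pu] := conj_index_exists g cP.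
have uw : u = w.
  apply/eqP; rewrite eqn_leq (conj_cap_index_le cU tP Pu Uw) /=.
  by rewrite -(minimizing_conj_index cU cP Uw Pu); exact: minU.
have [T [t [Tu [tX tD]]]] := conj_cap_index_ge cU tP Pu.
have tc : covers t [set x | U (conjz g (-1) x)] U.
  apply: (separated_covers sU (index_eq_le Uw)); first by rewrite Tu.
  by split=> // i; exact: (backward_sub (tX i)).
apply: expansion_tidy_above => // x /tc [i Ui].
by exists (t i), ((t i)^-1 * x)%g; rewrite mulVKg; split=> //; exact: tX.
Qed.

(** The n-th translate of [l] by g^k is in the overlap at time n k, but not one
step earlier, because glg^-1 is not in [U]. *)
Lemma overlap_jump g U l (k n : nat) : subgroup U -> (0 < k)%N -> (0 < n)%N ->
  backward g U l -> ~ U (conjz g 1 l) ->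
  (forall j : nat, (k <= j)%N -> U (conjz g j l)) ->
  index_ge (overlap g U (n * k)) (overlap g U (n.-1 * k)) 2.
Proof.
move=> sU k0 n0 Ul nUl Ukl; pose x := conjz g (n * k)%N l.
have sO := subgroup_overlap g (n * k) sU.
have Ox : overlap g U (n * k) x.
  split; first by apply: Ukl; rewrite -{1}(mul1n k) leq_mul2r n0 orbT.
  by rewrite /conjpre /= /x conjzK.
have nOx : ~ overlap g U (n.-1 * k) x.
  move=> [_ Ox']; apply: nUl.
  have -> : conjz g 1 l = conjz g (1 - (n * k)%N%:Z) x by rewrite /x -conjzD subrK.
  have le_nk : (n.-1 * k + k = n * k)%N.
    by case: n n0 {x Ox sO Ox'} => // n _; rewrite mulSn addnC.
  have := backward_le0 (z := (n.-1 * k)%N%:Z + (1 - (n * k)%N%:Z)) Ox'.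
  rewrite /conjpre -conjzD.
  have -> : (n.-1 * k)%N%:Z + (1 - (n * k)%N%:Z) + - (n.-1 * k)%N%:Z =
    1 - (n * k)%N%:Z by lia.
  by apply; lia.
exists bool, (fun b => if b then x else 1%g); rewrite card_bool; split=> //; split.
  by case=> //; exact: (subgroup1 sO).
have sO' := subgroup_overlap g (n.-1 * k) sU.
case=> [] [] //=.
- by rewrite mulg1 => /(subgroupV sO'); rewrite invgK.
- by rewrite invg1 mul1g.
Qed.

Lemma overlap_mono g U (m n : nat) : (m <= n)%N -> overlap g U m `<=` overlap g U n.
Proof. by move=> mn h [Uh Bh]; split=> //; exact: conjpre_backwardS Bh. Qed.

(** An element violating tidiness below makes the overlaps grow like 2^m along an
arithmetic progression, so the growth rate of [U] would be less than its
conjugation index. But this index is at most that of [V] by minimality, and the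
latter is the common growth rate, as [V] is tidy. *)
Lemma minimizing_tidy_below g U V : minimizing g U ->
  compact_open_subgroup V -> tidy_above g V -> tidy_below g V ->
  tidy_below g U.
Proof.
move=> mU cV tVA tVB; have tU := minimizing_tidy_above mU.
have [cU minU] := mU; have sU := co_subgroup cU.
have [u Uu] := conj_index_exists g cU; have [v Vv] := conj_index_exists g cV.
have le_uv : (u <= v)%N by rewrite -(minimizing_conj_index cU cV Uu Vv); exact: minU.
have u0 := conj_index_gt0 sU Uu.
move=> l0 Ul0 El0 j0; apply: contrapT => nUl0.
(* Conjugate so that the first time outside [U] becomes time 1. *)
have [l [Ul El nUl]] : exists l, [/\ backward g U l, eventual g U l & ~ U (conjz g 1 l)].
  elim: j0 nUl0 => [|j IH] nUl0.
    by case: nUl0; rewrite conjz0; exact: backward_sub.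
  have [Bj|/IH //] := pselect (U (conjz g j l0)).
  have ex : exists m, `[< ~ U (conjz g (Posz m) l0) >] by exists j.+1; apply/asboolP.
  case: (ex_minnP ex) => -[|m] /asboolP nUm min.
    by case: nUm; rewrite conjz0; exact: backward_sub.
  exists (conjz g m l0); split; [|exact: eventual_conjz|by rewrite -conjzD -intS].
  move=> n; rewrite -conjzD; have [nm|mn] := leqP n m; last first.
    by apply: backward_le0 => //; lia.
  have -> : - n%:Z + m%:Z = (m - n)%N%:Z by lia.
  apply: contrapT => nU; have := min (m - n)%N; rewrite ltnNge leq_subr.
  by move=> /(_ (asboolT nU)).
case: El => N El; pose k := N.+1.
have Ekl j : (k <= j)%N -> U (conjz g (Posz j) l) by move=> kj; apply: El; exact: ltnW.
have grow m : index_ge (overlap g U (m * k)) (backward g U) (2 ^ m).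
  elim: m => [|m IH].
    exists unit, (fun=> 1%g); rewrite card_unit; split=> //; split=> [_|[] []] //.
    exact: (subgroup1 (subgroup_overlap g _ sU)).
  rewrite expnS; apply: index_ge_mul (overlap_jump (n := m.+1) sU _ _ Ul nUl Ekl) IH => //.
  - exact: subgroup_overlap.
  - exact: subgroup_overlap.
  - by apply: overlap_mono; rewrite leq_mul2r leqnSn orbT.
  - exact: backward_overlap.
have [c vuc] := growth_comparison cV tVA tVB Vv cU tU Uu.
have := vuc _ _ (grow c).
have : (u ^ (c * k) <= v ^ (c * k))%N.
  by elim: (c * k)%N => // e IH; rewrite !expnS leq_mul.
have := ltn_expl c (isT : 1 < 2)%N.
have : (0 < u ^ (c * k))%N by rewrite expn_gt0 u0.
set a := (u ^ _)%N; set b := (v ^ _)%N; set d := (2 ^ _)%N.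
by move=> *; nia.
Qed.

End Minimizing.

(** * Existence of tidy subgroups *)
Section TidyExtension.
Context {G : topologicalGroupType}.
Implicit Types (h x y l q : G).
Variables (Q L : set G).
Hypotheses (cQ : compact_open_subgroup Q) (cL : compact L) (clL : closed L) (sL : subgroup L).
Hypothesis normL : forall l q, L l -> Q q -> Q (l * q * l^-1)%g.

Let V := mulset Q L.

Let sQ : subgroup Q := co_subgroup cQ.

Lemma sub_extension q : Q q -> V q.
Proof. by move=> Qq; exists q, 1%g; rewrite mulg1; split=> //; exact: (subgroup1 sL). Qed.

Lemma extension_sub l : L l -> V l.
Proof. by move=> Ll; exists 1%g, l; rewrite mul1g; split=> //; exact: (subgroup1 sQ). Qed.

Lemma co_extension : compact_open_subgroup V.
Proof.
have sV : subgroup V.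
  split=> [|x y]; first exact: (sub_extension (subgroup1 sQ)).
  move=> [q [l [Qq Ll ->]]] [q' [l' [Qq' Ll' ->]]].
  exists (q * ((l * l'^-1) * q'^-1 * (l * l'^-1)^-1))%g, (l * l'^-1)%g.
  have Lll' : L (l * l'^-1)%g by exact: sL.2.
  split=> //; last by rewrite !invgM !mulgA mulgVK mulgVK.
  exact: (subgroupM sQ Qq (normL Lll' (subgroupV sQ Qq'))).
split=> //; first exact: compact_mulset (co_compact cQ) cL.
exact: (open_superset sV sQ (co_open cQ) sub_extension).
Qed.

Let sV : subgroup V := co_subgroup co_extension.

(** The aim is that [V] is tidy when [L] contains all elements attracted into
[Q] by both [g] and its inverse. The statements about [backward] transfer to
[forward] by replacing [g] by its inverse. *)
Section Dynamics.
Variable g : G.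
Hypothesis invL : forall z l, L l -> L (conjz g z l).
Hypothesis tQ : tidy_above g Q.
Hypothesis homL : forall h, eventual g Q h -> eventual g^-1%g Q h -> L h.

Lemma extension_core l : L l -> core g V l.
Proof. by move=> Ll z; apply: extension_sub; exact: invL. Qed.

Lemma normal_eventual l h : L l -> eventual g Q h -> eventual g Q (l * h * l^-1)%g.
Proof.
move=> Ll [N Qh]; exists N => n Nn; rewrite !conjzM conjzV.
by apply: normL; [exact: invL|exact: Qh].
Qed.

(** In positive time the factor [a] is a quotient of elements of [V], and in
negative time it stays in [Q]. *)
Lemma core_factor v a b l : core g V v -> backward g Q a -> forward g Q b -> L l ->
  v = (a * b * l)%g -> core g V a.
Proof.
move=> Vv Qa Qb Ll vE z; have [z0|z0] := leP z 0.
  by apply: sub_extension; exact: backward_le0.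
have -> : a = ((v * l^-1) * b^-1)%g by rewrite vE !mulgK.
rewrite !conjzM !conjzV; apply: (subgroupM sV).
  by apply: (subgroupM sV (Vv z)); apply: (subgroupV sV); exact: extension_core.
by apply: (subgroupV sV); apply: sub_extension; apply: forward_ge0 => //; exact: ltW.
Qed.

Lemma core_factors y a b : core g V y -> backward g Q a -> forward g Q b ->
  y = (a * b)%g -> core g V a /\ core g V b.
Proof.
move=> Vy Qa Qb yE; have Va : core g V a.
  by apply: (core_factor Vy Qa Qb (subgroup1 sL)); rewrite mulg1.
split=> //; have sC := subgroup_core g sV.
by have := subgroupM sC (subgroupV sC Va) Vy; rewrite yE mulKg.
Qed.

(** Let X be the elements of the core of [V] attracted into [Q] by the inverse of
[g]. Finitely many cosets of [Q] cover X, so for some M every x in X is a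
product a b with a in the M-th conjugate of Q_+ and b in [L]. Applied to
g^(M+j) q g^-(M+j) and moved back, this puts [q] in (g^-j Q_+ g^j) L for each j;
compactness of [L] gives [q] in Q_0 L, which is [L]. *)
Lemma core_backward_extension q : core g V q -> backward g Q q -> L q.
Proof.
move=> Vq Qq; have sC := subgroup_core g sV.
pose X := core g V `&` eventual g^-1%g Q.
have sX : subgroup X by exact: (subgroupI sC (subgroup_eventual _ sQ)).
have [n0 Xn0] := index_le_compact (compact_core (g := g) co_extension) sQ (co_open cQ).
have [|n [T [e [_ [eX _] ec]]]] := index_eq_exists (X := X) sQ (n := n0).
  by apply: index_le_sub Xn0 => // h [].
have /choice[m mP] : forall i : T, exists m : nat, backward g Q (conjz g (- m%:Z) (e i)).
  by move=> i; have /eventualE[m] := (eX i).2; exists m; rewrite -conjVz -forwardV.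
pose M := (\max_i m i)%N.
have eM i : backward g Q (conjz g (- M%:Z) (e i)).
  have -> : - M%:Z = - (M - m i)%N%:Z + - (m i)%:Z.
    by have : (m i <= M)%N by [exact: leq_bigmax]; lia.
  by rewrite conjzD; apply: backward_conjz => //; lia.
have decX x : X x -> exists a b, [/\ backward g Q (conjz g (- M%:Z) a), L b & x = (a * b)%g].
  move=> Xx; have [i Qix] := ec x Xx.
  have [Viy Eiy] := subgroupM sX (subgroupV sX (eX i)) Xx.
  have [a [b [Qa Qb yE]]] := tQ Qix.
  have [Va Vb] := core_factors Viy Qa Qb yE.
  exists (e i * a)%g, b; split; last by rewrite -mulgA -yE mulVKg.
    rewrite conjzM; apply: (subgroupM (subgroup_backward g sQ) (eM i)).
    by apply: backward_conjz => //; lia.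
  apply: homL; first exact: forward_eventual.
  have sE := subgroup_eventual g^-1%g sQ.
  have Ea : eventual g^-1%g Q a by apply: forward_eventual; rewrite forwardV.
  by have := subgroupM sE (subgroupV sE Ea) Eiy; rewrite yE mulKg.
pose A (j : nat) := L `&` [set l | backward g Q (conjz g j (q * l^-1)%g)].
have clA j : closed (A j).
  apply: closedI => //.
  apply: (closed_comp (f := fun l : G => (l^-1)%g)
    (D := [set y | backward g Q (conjz g (Posz j) (q * y)%g)])).
    by move=> y _; exact: invg_continuous.
  apply: (closed_comp (f := fun y : G => (q * y)%g)
    (D := [set y | backward g Q (conjz g (Posz j) y)])).
    by move=> y _; exact: mulgl_continuous.
  exact: (closed_conjz (closed_backward (co_closed cQ))).
have [||||l lP] := nested_compact_nonempty (A := A).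
- by apply: (subclosed_compact (clA _) cL) => l [].
- exact: clA.
- move=> j l [Ll Ql]; split=> //=.
  have -> : j%:Z = -1 + j.+1%:Z by lia.
  by rewrite conjzD; apply: backward_conjz.
- move=> j; have [|a [b [Qa Lb qE]]] := decX (conjz g (M + j)%N q).
    split; first exact: core_conjz.
    rewrite -(opprK (Posz _)) -conjVz; apply: eventual_conjz.
    by apply: forward_eventual; rewrite forwardV.
  exists (conjz g (- (M + j)%N%:Z) b); split; first exact: invL.
  rewrite /= -conjzV; have {1}-> : q = conjz g (- (M + j)%N%:Z) (a * b)%g.
    by rewrite -qE conjzK.
  rewrite -conjzM mulgK -conjzD; have -> : j%:Z - (M + j)%N%:Z = - M%:Z by lia.
  by [].
have Ll := (lP 0%N).1.
have : L (q * l^-1)%g.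
  suff Cq : core g Q (q * l^-1)%g.
    by apply: homL; apply: core_eventual => //; rewrite coreV.
  move=> z; have := (lP (absz z)).2; rewrite /= => Qz.
  have -> : z = (z - (absz z)%:Z) + (absz z)%:Z by lia.
  by rewrite conjzD; apply: backward_le0 => //; lia.
by move=> /(subgroupM sL)/(_ Ll); rewrite mulgVK.
Qed.

End Dynamics.

Section TidyBelow.
Variable g : G.
Hypothesis invL : forall z l, L l -> L (conjz g z l).
Hypothesis tQ : tidy_above g Q.
Hypothesis homL : forall h, eventual g Q h -> eventual g^-1%g Q h -> L h.

Lemma core_forward_extension q : core g V q -> forward g Q q -> L q.
Proof.
rewrite -coreV -backwardV; apply: core_backward_extension.
- by move=> z l Ll; rewrite conjVz; exact: invL.
- exact: (tidy_aboveV sQ tQ).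
- by move=> h E1 E2; apply: homL => //; rewrite invgK in E2.
Qed.

(** The core of [V] is thus [L] itself, the converse inclusion being clear. *)
Lemma core_extension v : core g V v -> L v.
Proof.
move=> Vv; have [q [l [Qq Ll vE]]] := core_sub Vv.
have [a [b [Qa Qb qE]]] := tQ Qq.
have Vab : core g V (a * b)%g.
  have := subgroupM (subgroup_core g sV) Vv
    (subgroupV (subgroup_core g sV) (extension_core invL Ll)).
  by rewrite vE mulgK qE.
have [Va Vb] := core_factors invL Vab Qa Qb erefl.
rewrite vE qE; apply: (subgroupM sL) => //; apply: (subgroupM sL).
  exact: core_backward_extension Qa.
exact: core_forward_extension Qb.
Qed.

Lemma tidy_above_extension : tidy_above g V.
Proof.
move=> v [q [l [Qq Ll vE]]]; have [a [b [Qa Qb qE]]] := tQ Qq.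
exists a, (b * l)%g; split; last by rewrite vE qE mulgA.
- exact: backwardS sub_extension _ Qa.
- apply: (subgroupM (subgroup_forward g sV)); first exact: forwardS sub_extension _ Qb.
  exact: core_forward (extension_core invL Ll).
Qed.

(** Two elements q of Q_+ whose quotients by l are in Q_--, with l in a common
coset of [Q], differ by elements of [L] only: after moving the Q_+ and Q_-
factors of the quotient of the two l across, their quotient is in Q_+ and in
Q_--. As [L] is in the core of [V], one bound serves the whole coset. *)
Lemma extension_uniform : exists N : nat, forall l q, L l -> backward g Q q ->
  eventual g Q (q * l^-1)%g -> forall n : nat, (N <= n)%N -> V (conjz g n q).
Proof.
have /compact_near_coveringP/near_covering_withinP nc := cL.
pose P (N : nat) l := forall q, backward g Q q -> eventual g Q (q * l^-1)%g ->
  forall n : nat, (N <= n)%N -> V (conjz g n q).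
suff [N _ NP] : \forall N \near \oo, L `<=` P N.
  by exists N => l q Ll; exact: (NP N (leqnn N)).
apply: (nc nat \oo P) => l0 Ll0.
have nl0 : nbhs l0 [set l | Q (l0^-1 * l)%g].
  apply: open_nbhs_nbhs; split; first by apply: open_mull; exact: co_open.
  by rewrite /= mulVg; exact: (subgroup1 sQ).
have [[l1 [q1 [Ll1 Q01 Qq1 Eq1]]]|no] := pselect (exists l1 q1,
    [/\ L l1, Q (l0^-1 * l1)%g, backward g Q q1 & eventual g Q (q1 * l1^-1)%g]); last first.
  exists ([set l | Q (l0^-1 * l)%g], setT) => /=; first by split=> //; exact: filterT.
  move=> [l N] /= [Ql _] Ll q Qq Eq; exfalso; apply: no.
  by exists l, q.
have [N VN] : eventual g V q1.
  have -> : q1 = ((q1 * l1^-1) * l1)%g by rewrite mulgVK.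
  apply: (subgroupM (subgroup_eventual g sV)); first exact: eventualS sub_extension _ Eq1.
  exact: core_eventual (extension_core invL Ll1).
exists ([set l | Q (l0^-1 * l)%g], [set n | (N <= n)%N]) => /=.
  by split=> //; exists N.
move=> [l n] /= [Ql Nn] Ll q Qq Eq m nm.
have Qd : Q (l^-1 * l1)%g.
  by have := subgroupM sQ (subgroupV sQ Ql) Q01; rewrite invgM invgK mulgA mulgK.
have Ld : L (l^-1 * l1)%g by exact: (subgroupM sL (subgroupV sL Ll) Ll1).
have [a [b [Qa Qb dE]]] := tQ Qd.
have [Va Vb] := core_factors invL (extension_core invL Ld) Qa Qb dE.
have La : L a by exact: core_backward_extension Qa.
have Lb : L b by exact: core_forward_extension Qb.
have sE := subgroup_eventual g sQ; have sB := subgroup_backward g sQ.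
have Eqa : eventual g Q (q * a * l1^-1)%g.
  have -> : (q * a * l1^-1 = (q * l^-1) * (l1 * b^-1 * l1^-1))%g.
    have -> : (a = (l^-1 * l1) * b^-1)%g by rewrite dE mulgK.
    by rewrite !mulgA.
  apply: (subgroupM sE Eq); apply: (normal_eventual invL Ll1).
  exact: (subgroupV sE (forward_eventual Qb)).
have Bqa : backward g Q (q * a)%g by exact: (subgroupM sB Qq Qa).
have Lh : L (q * a * q1^-1)%g.
  apply: homL.
    have := subgroupM sE Eqa (subgroupV sE Eq1).
    by rewrite invgM invgK mulgA mulgVK.
  by apply: forward_eventual; rewrite forwardV; exact: (subgroupM sB Bqa (subgroupV sB Qq1)).
have -> : (q = (q * a * q1^-1) * q1 * a^-1)%g by rewrite mulgVK mulgK.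
rewrite 2!conjzM; apply: (subgroupM sV).
  apply: (subgroupM sV); first by apply: extension_sub; exact: invL.
  by apply: VN; exact: leq_trans nm.
by apply: extension_sub; apply: invL; exact: (subgroupV sL La).
Qed.

(** By [eventual_decomposition] an element of V_-- has a factor in Q_--, and by
[core_forward_extension] an element of V_+ differs from one of Q_+ by elements
of [L]; this is the situation of [extension_uniform]. *)
Lemma tidy_below_extension : tidy_below g V.
Proof.
have [N NP] := extension_uniform.
apply: (uniform_tidy_below (N := N)) => h Vh Eh n Nn.
have sE := subgroup_eventual g sQ.
have [q1 [l1 [Eq1 /core_extension Ll1 hE]]] :=
  eventual_decomposition co_extension cQ sub_extension tQ Eh.
have [q [l [Qq Ll hE']]] := backward_sub Vh.
have [a [b [Qa Qb qE]]] := tQ (subgroupV sQ Qq).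
have qE' : q = (b^-1 * a^-1)%g by rewrite -invgM -qE invgK.
have Qb' := subgroupV (subgroup_forward g sQ) Qb.
have Qa' := subgroupV (subgroup_backward g sQ) Qa.
have Lb : L b^-1%g.
  apply: core_forward_extension (Qb'); apply: coreP; last exact: forwardS sub_extension _ Qb'.
  have -> : (b^-1 = h * l^-1 * a)%g by rewrite hE' qE' mulgK mulgVK.
  have sB := subgroup_backward g sV.
  apply: (subgroupM sB); last exact: backwardS sub_extension _ Qa.
  apply: (subgroupM sB Vh); apply: (subgroupV sB).
  exact: core_backward (extension_core invL Ll).
have Lb' : L b by have := subgroupV sL Lb; rewrite invgK.
have aE : (a^-1 = b * h * l^-1)%g by rewrite hE' qE' !mulgA mulgV mul1g mulgK.
have Va : V (conjz g n a^-1%g).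
  apply: (NP (b * l1 * l^-1)%g) => //.
    exact: (subgroupM sL (subgroupM sL Lb' Ll1) (subgroupV sL Ll)).
  rewrite aE hE; have -> : (b * (q1 * l1) * l^-1 * (b * l1 * l^-1)^-1 = b * q1 * b^-1)%g.
    by rewrite !invgM !mulgA invgK mulgVK mulgK.
  exact: (normal_eventual invL Lb').
have -> : h = (b^-1 * a^-1 * l)%g by rewrite -qE'.
rewrite 2!conjzM; apply: (subgroupM sV).
  by apply: (subgroupM sV) => //; apply: extension_sub; exact: invL.
by apply: extension_sub; exact: invL.
Qed.

End TidyBelow.
End TidyExtension.

Section TidyExists.
Context {G : topologicalGroupType}.
Implicit Types (g h x y l q : G) (U L : set G).

Lemma subgroup_closure U : subgroup U -> subgroup (closure U).
Proof.
move=> sU; split; first by apply: subset_closure; exact: subgroup1.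
move=> x y Ux Uy W Wxy.
have : nbhs (x, y) [set z : G * G | W (z.1 * z.2^-1)%g].
  apply: (@continuous_comp _ _ _ (fun z : G * G => (z.1, (z.2^-1)%g))
    (fun z : G * G => (z.1 * z.2)%g) (x, y) _ _ W Wxy).
    apply: cvg_pair => /=; first exact: cvg_fst.
    apply: (@cvg_comp _ _ _ snd (fun y : G => (y^-1)%g) _ (nbhs y)).
      exact: cvg_snd.
    exact: invg_continuous.
  exact: mulg_continuous.
case=> -[A B] /= [Ax By] AB.
have [a [Ua Aa]] := Ux _ Ax; have [b [Ub Bb]] := Uy _ By.
by exists (a * b^-1)%g; split; [exact: sU.2|exact: (AB (a, b))].
Qed.

Lemma closure_conjz g (z : int) U h : (forall h, U h -> U (conjz g z h)) ->
  closure U h -> closure U (conjz g z h).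
Proof.
move=> invU Uh W /(conjz_continuous (g := g)) Wh.
by have [a [Ua Wa]] := Uh _ Wh; exists (conjz g z a); split=> //; exact: invU.
Qed.

Definition homoclinic g U : set G := eventual g U `&` eventual g^-1%g U.

Lemma subgroup_homoclinic g U : subgroup U -> subgroup (homoclinic g U).
Proof. by move=> sU; apply: subgroupI; exact: subgroup_eventual. Qed.

Lemma homoclinic_conjz g U (z : int) h : homoclinic g U h -> homoclinic g U (conjz g z h).
Proof.
by move=> [E1 E2]; split; [|rewrite -[z]opprK -conjVz]; exact: eventual_conjz.
Qed.

(** Let H be the homoclinic elements in U_+. Finitely many elements of g H g^-1
represent it modulo H, and from time M on their conjugates are all in [U]. So
the (m+1)-st conjugate of H is inside U times the m-th one, for m >= M, and
every homoclinic element is in some conjugate of H. *)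
Lemma homoclinic_bounded g U : compact_open_subgroup U ->
  exists M : nat, homoclinic g U `<=` mulset (conjpre g (- M%:Z) U) U.
Proof.
move=> cU; have sU := co_subgroup cU.
pose X := conjpre g (-1) (homoclinic g U `&` backward g U).
have sH := subgroupI (subgroup_homoclinic g sU) (subgroup_backward g sU).
have sX : subgroup X := subgroup_conjz g (-1) sH.
have [n0 Un0] := index_le_compact
  (compact_conjz (g := g) (z := -1) (co_compact cU)) sU (co_open cU).
have [|n [T [t [_ [tX _] tc]]]] := index_eq_exists (X := X) sU (n := n0).
  by apply: index_le_sub Un0 => // h [_ /backward_sub].
have Xmeet h : X h -> U h -> (homoclinic g U `&` backward g U) h.
  move=> [Hh Bh] Uh; split; last exact: conjpre_backward_meet.
  by rewrite -(conjzKV g 1 h); exact: homoclinic_conjz.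
have /choice[m mP] : forall i : T, exists m : nat, forall j : nat, (m <= j)%N ->
    U (conjz g j (t i)).
  by move=> i; have [[E _] _] := tX i; have := eventual_conjz 1 E; rewrite conjzKV.
pose M := (\max_i m i)%N.
have tM i (j : nat) : (M <= j)%N -> U (conjz g j (t i)).
  by move=> Mj; apply: mP; apply: leq_trans Mj; exact: leq_bigmax.
have key (k : nat) x : conjpre g (- (M + k)%N%:Z) (homoclinic g U `&` backward g U) x ->
    mulset U (conjpre g (- M%:Z) U) x.
  elim: k x => [|k IH] x Hx.
    exists 1%g, x; rewrite mul1g; split=> //; first exact: (subgroup1 sU).
    by rewrite addn0 in Hx; exact: backward_sub Hx.2.
  pose y := conjz g (- (M + k)%N%:Z) x.
  have Xy : X y.
    have yE : conjz g (-1) y = conjz g (- (M + k.+1)%N%:Z) x.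
      by rewrite /y -conjzD; congr conjz; lia.
    by rewrite /X /conjpre /mkset yE.
  have [i Ui] := tc _ Xy.
  have [Hz Bz] := Xmeet _ (subgroupM sX (subgroupV sX (tX i)) Xy) Ui.
  have [|u [a [Uu Ua zE]]] := IH (conjz g (M + k)%N ((t i)^-1 * y)%g).
    by rewrite /conjpre /= conjzK.
  exists (conjz g (M + k)%N (t i) * u)%g, a; split=> //.
    by apply: (subgroupM sU) => //; apply: tM; exact: leq_addr.
  by rewrite -mulgA -zE -conjzM mulVKg /y conjzKV.
exists M => h Hh.
have Hh' := subgroupV (subgroup_homoclinic g sU) Hh.
have /eventualE[k Bk] := Hh'.2.
have [|u [a [Uu Ua hE]]] := key k h^-1%g.
  split; first exact: homoclinic_conjz.
  have -> : - (M + k)%N%:Z = - M%:Z - k%:Z by lia.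
  rewrite conjzD; apply: backward_conjz; first by lia.
  by rewrite -conjVz -forwardV.
exists a^-1%g, u^-1%g; split.
- exact: (subgroupV (subgroup_conjz g (- M%:Z) sU) Ua).
- exact: (subgroupV sU Uu).
- by rewrite -invgM -hE invgK.
Qed.

Lemma compact_closure_homoclinic g U : compact_open_subgroup U ->
  compact (closure (homoclinic g U)).
Proof.
move=> cU; have sU := co_subgroup cU; have [M HM] := homoclinic_bounded g cU.
have cS : compact (mulset (conjpre g (- M%:Z) U) U).
  by apply: compact_mulset (co_compact cU); exact: compact_conjz (co_compact cU).
apply: (subclosed_compact _ cS); first exact: closed_closure.
rewrite (closure_id (mulset _ _)).1; first exact: closure_subset.
apply: (closed_union_coset sU (co_open cU)) => x u [a [v [Ua Uv ->]]] Uu.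
by exists a, (v * u)%g; rewrite mulgA; split=> //; exact: (subgroupM sU).
Qed.

Lemma co_normal_core L U : compact L -> subgroup L -> compact_open_subgroup U ->
  compact_open_subgroup [set u | forall l, L l -> U (l * u * l^-1)%g].
Proof.
move=> cL sL cU; have sU := co_subgroup cU.
set W := [set u | _].
have sW : subgroup W.
  split=> [l _|x y Wx Wy l Ll]; first by rewrite mulg1 mulgV; exact: (subgroup1 sU).
  have -> : (l * (x * y^-1) * l^-1 = (l * x * l^-1) * (l * y * l^-1)^-1)%g.
    by rewrite !invgM invgK !mulgA mulgVK.
  by apply: sU.2; [exact: Wx|exact: Wy].
have oW : open W.
  rewrite openE => u Wu.
  have /compact_near_coveringP nc := cL.
  apply: (nc G (nbhs u) (fun u l => U (l * u * l^-1)%g)) => l Ll.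
  have Ul := open_nbhs_nbhs (conj (co_open cU) (Wu l Ll)).
  have [[A B] /= [Alu Bl] AB] := mulg_cvg Ul.
  have [[C D] /= [Cl Du] CD] := mulg_cvg Alu.
  exists (C `&` [set l' | B l'^-1%g], D) => /=.
    by split=> //; apply: filterI => //; exact: (@invg_continuous G l _ Bl).
  move=> [l' u'] /= [[Cl' Bl'] Du'].
  by apply: (AB ((l' * u')%g, l'^-1%g)); split=> //=; exact: (CD (l', u')).
split=> //; apply: (subclosed_compact _ (co_compact cU)).
  exact: open_subgroup_closed.
by move=> u /(_ 1%g (subgroup1 sL)); rewrite mul1g invg1 mulg1.
Qed.

(** The intersection of the conjugates of [U] by [L] is still open, as [L] is
compact, and normalized by [L]; so are its finite intersections of conjugates by
powers of [g], one of which is tidy above. *)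
Lemma tidy_exists g U : compact_open_subgroup U ->
  exists V, [/\ compact_open_subgroup V, tidy_above g V & tidy_below g V].
Proof.
move=> cU; pose L := closure (homoclinic g U).
have cL : compact L := compact_closure_homoclinic (g := g) cU.
have sL : subgroup L := subgroup_closure (subgroup_homoclinic g (co_subgroup cU)).
have invL z l : L l -> L (conjz g z l).
  by apply: closure_conjz => h; exact: homoclinic_conjz.
have cQ' := co_normal_core cL sL cU.
set Q' := [set u | _] in cQ'.
have [N tQ] := tidy_above_conj_cap g cQ'.
have cQ := co_conj_cap g N cQ'.
have normL l q : L l -> conj_cap g Q' N q -> conj_cap g Q' N (l * q * l^-1)%g.
  move=> Ll Qq i iN l' Ll'; rewrite !conjzM conjzV.
  set c := conjz g _ l.
  have -> : (l' * (c * conjz g (- i%:Z) q * c^-1) * l'^-1 =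
    (l' * c) * conjz g (- i%:Z) q * (l' * c)^-1)%g by rewrite !invgM !mulgA.
  by apply: (Qq i iN); apply: (subgroupM sL Ll'); exact: invL.
have Q'U : Q' `<=` U.
  by move=> u /(_ 1%g (subgroup1 sL)); rewrite mul1g invg1 mulg1.
have QU : conj_cap g Q' N `<=` U by move=> h /conj_cap_sub /Q'U.
have homL h : eventual g (conj_cap g Q' N) h -> eventual g^-1%g (conj_cap g Q' N) h -> L h.
  by move=> /(eventualS QU) E1 /(eventualS QU) E2; apply: subset_closure.
have clL : closed L by exact: closed_closure.
exists (mulset (conj_cap g Q' N) L); split.
- exact: co_extension.
- exact: tidy_above_extension.
- exact: tidy_below_extension.
Qed.

End TidyExists.

(** * The contraction group relative to K *)
Section UniformContraction.
Context {G : topologicalGroupType}.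
Implicit Types (g h x y l q : G) (C D O P S U W K : set G).

(** Otherwise no coset of a finite intersection of the [D m] would lie in one of
the sets [H n] of elements of [C] that are in all [D m] from time n on: by
compactness finitely many translates would cover [C] and the bound would be
uniform. So there are nested cosets that avoid each [H n] in turn, and a point
common to them contradicts the hypothesis. *)
Lemma uniform_eventually C (D : nat -> set G) : compact C -> closed C -> subgroup C ->
  (forall m, subgroup (D m)) -> (forall m, open (D m)) ->
  (forall c, C c -> exists N, forall m, (N <= m)%N -> D m c) ->
  exists N, forall m c, (N <= m)%N -> C c -> D m c.
Proof.
move=> cC clC sC sD oD evD; apply: contrapT => /forallNP nunif.
pose H (n : nat) := [set c | forall m, (n <= m)%N -> D m c].
pose B (k : nat) := [set c | forall m, (m <= k)%N -> D m c].
have sB k : subgroup (B k).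
  split=> [m _|x y Bx By m mk]; first exact: subgroup1.
  by apply: (sD m).2; [exact: Bx|exact: By].
have sH k : subgroup (H k).
  split=> [m _|x y Bx By m mk]; first exact: subgroup1.
  by apply: (sD m).2; [exact: Bx|exact: By].
have oB k : open (B k).
  elim: k => [|k IH].
    have -> : B 0%N = D 0%N; last exact: oD.
    apply/seteqP; split=> c; first by move=> /(_ 0%N (leqnn _)).
    by move=> Dc m; rewrite leqn0 => /eqP ->.
  have -> : B k.+1 = B k `&` D k.+1; last exact: openI.
  apply/seteqP; split=> [c Bc|c [Bc Dc] m].
    by split=> [m mk|]; apply: Bc => //; exact: leqW.
  by rewrite leq_eqVlt => /orP[/eqP -> //|]; exact: Bc.
have step n x k : C x -> exists x' k', [/\ C x', B k (x^-1 * x')%g, (k <= k')%N &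
    forall w, B k' w -> ~ H n (x' * w)%g].
  move=> Cx; have [[x' [Cx' Bx' nHx']]|no] := pselect (exists x',
      [/\ C x', B k (x^-1 * x')%g & ~ H n x']).
    have [m nm nDm] : exists2 m, (n <= m)%N & ~ D m x'.
      by apply: contrapT => nex; apply: nHx' => m nm; apply: contrapT => nD;
         apply: nex; exists m.
    exists x', (maxn k m); split=> //; first exact: leq_maxl.
    move=> w Bw /(_ m nm) Dxw; apply: nDm.
    have := subgroupM (sD m) Dxw (subgroupV (sD m) (Bw m (leq_maxr _ _))).
    by rewrite mulgK.
  exfalso; have sub y : C y -> B k (x^-1 * y)%g -> H n y.
    by move=> Cy By; apply: contrapT => nHy; apply: no; exists y.
  have Hx : H n x by apply: sub => //; rewrite mulVg; exact: subgroup1.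
  have [n0 Cn0] := index_le_compact cC (sB k) (oB k).
  have [p [T [t [_ [tC _] tc]]]] := index_eq_exists (sB k) Cn0.
  have /choice[f fP] : forall i : T, exists N, forall m, (N <= m)%N -> D m (t i).
    by move=> i; exact: evD.
  pose M := (\max_i f i)%N.
  apply: (nunif (maxn n M)) => m c; rewrite geq_max => /andP[nm Mm] Cc.
  have [i Bi] := tc c Cc.
  have Hi : H n ((t i)^-1 * c)%g.
    have := subgroupM (sH n) (subgroupV (sH n) Hx) (sub (x * ((t i)^-1 * c))%g _ _).
    rewrite mulKg; apply => //.
    exact: (subgroupM sC Cx (subgroupM sC (subgroupV sC (tC i)) Cc)).
  rewrite -(mulVKg (t i) c); apply: (subgroupM (sD m)); last exact: Hi.
  by apply: fP; apply: leq_trans Mm; exact: leq_bigmax.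
pose st := {p : G * nat | C p.1}.
have /choice[F FP] : forall np : nat * st, exists p' : st,
    [/\ B (sval np.2).2 ((sval np.2).1^-1 * (sval p').1)%g,
      ((sval np.2).2 <= (sval p').2)%N &
      forall w, B (sval p').2 w -> ~ H np.1 ((sval p').1 * w)%g].
  move=> [n [[x k] /= Cx]]; have [x' [k' [Cx' Bx' kk' nH]]] := step n x k Cx.
  by exists (exist _ (x', k') Cx').
pose s := nat_rect (fun=> st) (exist _ (1%g, 0%N) (subgroup1 sC) : st)
  (fun n p => F (n, p)).
pose X n := (sval (s n)).1; pose k n := (sval (s n)).2.
pose A n := C `&` [set y | B (k n) ((X n)^-1 * y)%g].
have decB m n : (m <= n)%N -> B n `<=` B m.
  by move=> mn c Bc i im; apply: Bc; exact: leq_trans mn.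
have clA n : closed (A n).
  apply: closedI => //.
  apply: (closed_comp (f := fun y : G => ((X n)^-1 * y)%g) (D := B (k n))).
    by move=> y _; exact: mulgl_continuous.
  exact: open_subgroup_closed.
have [||||x xA] := nested_compact_nonempty (A := A).
- by apply: (subclosed_compact (clA _) cC) => y [].
- exact: clA.
- move=> n y [Cy By]; split=> //=; have [FB Fk _] := FP (n, s n).
  have := subgroupM (sB (k n)) FB (decB _ _ Fk _ By).
  by rewrite mulgA mulgK.
- move=> n; exists (X n); split; first exact: (svalP (s n)).
  by rewrite /= mulVg; exact: subgroup1.
have [N xN] := evD x (xA 0%N).1.
have [_ _ nH] := FP (N, s N).
by apply: (nH _ (xA N.+1).2); rewrite mulVKg.
Qed.

(** From here on [K] is an invariant compact subgroup presented as the
intersection of a decreasing sequence of compact open subgroups [V r]. *)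
Variables (g : G) (K : set G) (V : nat -> set G).
Hypothesis cV : forall r, compact_open_subgroup (V r).
Hypothesis decV : forall r, V r.+1 `<=` V r.
Hypothesis KE : K = \bigcap_r V r.
Hypothesis invK : forall z k, K k -> K (conjz g z k).

Lemma K_sub_V r : K `<=` V r.
Proof. by rewrite KE => k /(_ r I). Qed.

Lemma V_sub_open O : open O -> K `<=` O -> exists r, V r `<=` O.
Proof.
move=> oO KO; apply: (nested_compact_sub (co_compact (cV 0))) => //.
  by move=> n; exact: co_closed (cV n).
by rewrite -KE.
Qed.

(** The [V r] are unions of cosets of [K] and form a basis of neighbourhoods of
[K], so they define the convergence to [K] in the coset space. *)
Lemma con_eventual h : con g K h <-> forall r, eventual g (V r) h.
Proof.
split=> [ch r|evh W oW W1].
  have sV := co_subgroup (cV r).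
  have cosK x : (left_coset x K `<=` V r) = V r x.
    rewrite propeqE; split=> [xV|Vx y [k Kk <-]].
      apply: xV; exists 1%g; last by rewrite mulg1.
      by rewrite KE => i _; exact: subgroup1 (co_subgroup (cV i)).
    by apply: (subgroupM sV) => //; exact: K_sub_V.
  have := ch [set T | T `<=` V r]; rewrite /= cosK.
  case.
  - have -> : [set x | left_coset x K `<=` V r] = V r.
      by apply/seteqP; split=> x; rewrite /= cosK.
    exact: co_open.
  - exact: subgroup1.
  move=> N _ Nh; exists N => n Nn; rewrite -cosK conjzE; exact: Nh.
have [|r VO] := V_sub_open oW.
  move=> k Kk /=; have -> : left_coset k K = left_coset 1%g K => //.
  have sK : subgroup K.
    rewrite KE; split=> [i _|x y Vx Vy i _]; first exact: subgroup1 (co_subgroup (cV i)).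
    by apply: (co_subgroup (cV i)).2; [exact: Vx|exact: Vy].
  apply/seteqP; split=> x [l Kl <-].
    by exists (k * l)%g; rewrite ?mul1g //; exact: subgroupM.
  exists (k^-1 * l)%g; first exact: (subgroupM sK (subgroupV sK Kk) Kl).
  by rewrite mulVKg mul1g.
have [N Nh] := evh r; exists N => // n Nn.
by have := VO _ (Nh n Nn); rewrite conjzE.
Qed.

Lemma subgroup_con : subgroup (con g K).
Proof.
split=> [|x y /con_eventual Ex /con_eventual Ey].
  by apply/con_eventual => r; exact: subgroup1 (subgroup_eventual g (co_subgroup (cV r))).
apply/con_eventual => r; exact: (subgroup_eventual g (co_subgroup (cV r))).2.
Qed.

Lemma con_eventual_open O h : open O -> K `<=` O -> con g K h -> eventual g O h.
Proof.
move=> oO KO /con_eventual Eh; have [r /eventualS] := V_sub_open oO KO.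
by apply; exact: Eh.
Qed.

(** The group-theoretic form of condition (c), with [S] the stabilizer of a point. *)
Definition uniformly_contracted S := forall r, exists N : nat,
  forall n h, (N <= n)%N -> con g K h -> S h -> V r (conjz g (Posz n) h).

(** For h in the closure and c in con(g/K) close to h, the element h^-1 c of [S]
is approximated by elements of con(g/K) in [S] modulo arbitrarily small
subgroups, which inherit the uniform bound. *)
Lemma closed_con S : subgroup S -> open S -> uniformly_contracted S -> closed (con g K).
Proof.
move=> sS oS unif h clh; have sC := subgroup_con.
have near O : subgroup O -> open O -> exists2 c, con g K c & O (h^-1 * c)%g.
  move=> sO oO; have [|c [Cc Oc]] := clh [set c | O (h^-1 * c)%g]; last by exists c.
  apply: open_nbhs_nbhs; split; first exact: open_mull.
  by rewrite /= mulVg; exact: subgroup1.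
have [c Cc Shc] := near S sS oS.
suff Cs : con g K (h^-1 * c)%g.
  by have := subgroupM sC Cc (subgroupV sC Cs); rewrite invgM invgK mulVKg.
apply/con_eventual => r; have [N NP] := unif r; exists N => n Nn.
have sV := subgroup_conjz g n (co_subgroup (cV r)).
have [||c' Cc' [Sc' Vc']] := near (S `&` [set x | V r (conjz g (Posz n) x)]).
- exact: subgroupI.
- by apply: openI => //; apply: open_conjz; exact: co_open.
have -> : (h^-1 * c = (h^-1 * c') * ((h^-1 * c')^-1 * (h^-1 * c)))%g by rewrite mulVKg.
rewrite conjzM; apply: (subgroupM (co_subgroup (cV r)) Vc').
apply: NP => //; last exact: (subgroupM sS (subgroupV sS Sc') Shc).
have := subgroupM sC (subgroupV sC Cc') Cc.
by rewrite invgM invgK mulgA mulgK.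
Qed.

Lemma closed_con_uniform S O : closed (con g K) -> compact_open_subgroup S ->
  compact_open_subgroup O -> K `<=` O -> exists N : nat,
    forall n h, (N <= n)%N -> con g K h -> S h -> O (conjz g (Posz n) h).
Proof.
move=> clC cS cO KO.
have [|||||| N NP] := uniform_eventually (C := con g K `&` S)
    (D := fun m => conjpre g (Posz m) O).
- apply: (subclosed_compact _ (co_compact cS)); last by move=> h [].
  by apply: closedI => //; exact: co_closed.
- by apply: closedI => //; exact: co_closed.
- exact: (subgroupI subgroup_con (co_subgroup cS)).
- by move=> m; exact: subgroup_conjz (co_subgroup cO).
- by move=> m; exact: open_conjz (co_open cO).
- by move=> c [Cc _]; exact: (con_eventual_open (co_open cO) KO Cc).
by exists N => n h Nn Ch Sh; exact: NP.
Qed.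

Lemma tidy_chain P : compact_open_subgroup P -> tidy_above g P -> K `<=` P ->
  exists Q : nat -> set G, Q 0%N = P /\ forall i,
    [/\ compact_open_subgroup (Q i), tidy_above g (Q i), K `<=` Q i,
        Q i.+1 `<=` Q i & Q i.+1 `<=` V i].
Proof.
move=> cP tP KP.
have /choice[T TP] : forall O, exists N, compact_open_subgroup O ->
    tidy_above g (conj_cap g O N).
  move=> O; have [cO|nO] := pselect (compact_open_subgroup O); last by exists 0%N.
  by have [N tN] := tidy_above_conj_cap g cO; exists N.
pose Q : nat -> set G := nat_rect (fun=> set G) P
  (fun i (O : set G) => conj_cap g (O `&` V i) (T (O `&` V i))).
have cI (O : set G) i : compact_open_subgroup O -> compact_open_subgroup (O `&` V i).
  move=> cq; split; first exact: subgroupI (co_subgroup cq) (co_subgroup (cV i)).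
    by apply: compact_closedI; [exact: co_compact|exact: co_closed].
  by apply: openI; exact: co_open.
have QP i : [/\ compact_open_subgroup (Q i), tidy_above g (Q i) & K `<=` Q i].
  elim: i => //= i [cQ tQ KQ]; split; first exact: co_conj_cap (cI _ _ cQ).
    exact: TP (cI _ _ cQ).
  move=> k Kk j _; have Kj := invK (- j%:Z) Kk.
  by split; [exact: KQ|exact: K_sub_V].
exists Q; split=> // i; have [cQ tQ KQ] := QP i; split=> //= h /conj_cap_sub [] //.
Qed.

(** Along a chain of subgroups Q_i tidy above and shrinking to [K],
[eventual_decomposition] removes from [h] successive factors in the cores of the
Q_i. The products [p i] of these factors need not converge, but they are nested
modulo the cores, so compactness gives a common limit [l]; then h l^-1 is
attracted into every Q_i. *)
Lemma eventual_con_core P : compact_open_subgroup P -> tidy_above g P -> K `<=` P ->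
  eventual g P `<=` mulset (con g K) (core g P).
Proof.
move=> cP tP KP h Eh; have [Q [Q0 QP]] := tidy_chain cP tP KP.
have sE i := subgroup_eventual g (co_subgroup (let: And5 c _ _ _ _ := QP i in c)).
have sC i := subgroup_core g (co_subgroup (let: And5 c _ _ _ _ := QP i in c)).
have /choice[F FP] : forall ix : nat * G, exists l, eventual g (Q ix.1) ix.2 ->
    core g (Q ix.1) l /\ eventual g (Q ix.1.+1) (ix.2 * l^-1)%g.
  move=> [i x]; have [Ex|nEx] := pselect (eventual g (Q i) x); last by exists 1%g.
  have [cQ _ _ QQ _] := QP i; have [cQ' tQ' _ _ _] := QP i.+1.
  have [x' [l [Ex' Cl ->]]] := eventual_decomposition cQ cQ' QQ tQ' Ex.
  by exists l => _; rewrite mulgK.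
pose p := nat_rect (fun=> G) 1%g (fun i q => (F (i, (h * q^-1)%g) * q)%g).
have pE i : eventual g (Q i) (h * (p i)^-1)%g.
  elim: i => [|i IH]; first by rewrite /= Q0 invg1 mulg1.
  by have := (FP (i, (h * (p i)^-1)%g) IH).2; rewrite /= invgM mulgA.
pose A i : set G := [set x | core g (Q i) (x * (p i)^-1)%g].
have coreQS i : core g (Q i.+1) `<=` core g (Q i).
  by apply: coreS; case: (QP i).
have [||||l lA] := nested_compact_nonempty (A := A).
- have -> : A 0%N = core g P.
    by apply/seteqP; split=> x; rewrite /A /= Q0 invg1 mulg1.
  exact: compact_core.
- move=> i; apply: closed_mulr; apply: closed_core.
  by case: (QP i) => c _ _ _ _; exact: co_closed.
- move=> i x Ax; have /= [Cl _] := FP (i, (h * (p i)^-1)%g) (pE i).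
  have := subgroupM (sC i) (coreQS _ _ Ax) Cl.
  by rewrite /= invgM -mulgA mulgVK.
- move=> i; exists (p i); rewrite /A /= mulgV; exact: (subgroup1 (sC i)).
exists (h * l^-1)%g, l; split; last by rewrite mulgVK.
- apply/con_eventual => r; have [_ _ _ _ QV] := QP r; apply: (eventualS QV).
  have := subgroupM (sE r.+1) (pE r.+1) (subgroupV (sE r.+1) (core_eventual (lA r.+1))).
  by move: (p r.+1) => q; rewrite invgM invgK mulgA mulgVK.
- by have := lA 0%N; rewrite /A /= Q0 invg1 mulg1.
Qed.

Lemma K_sub_conj_cap O N : K `<=` O -> K `<=` conj_cap g O N.
Proof. by move=> KO k Kk i _; apply: KO; exact: invK. Qed.

Lemma nub_sub_of_closed_con : closed (con g K) -> nub g `<=` K.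
Proof.
move=> clC h nubh; rewrite KE => r _.
have [N tP] := tidy_above_conj_cap g (cV r); have cP := co_conj_cap g N (cV r).
have KP := K_sub_conj_cap (N := N) (@K_sub_V r).
have sP := co_subgroup cP.
suff tB : tidy_below g (conj_cap g (V r) N).
  by apply: (conj_cap_sub (g := g) (N := N)); apply: nubh; exact: tidy_minimizing.
have [M MP] := closed_con_uniform clC cP cP KP.
apply: (uniform_tidy_below (N := M)) => x Bx Ex n Mn.
have [c [l [Cc Cl xE]]] := eventual_con_core cP tP KP Ex.
have Pc : conj_cap g (V r) N c.
  have -> : c = (x * l^-1)%g by rewrite xE mulgK.
  exact: (subgroupM sP (backward_sub Bx) (subgroupV sP (core_sub Cl))).
rewrite xE conjzM; apply: (subgroupM sP); first exact: MP.
exact: Cl.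
Qed.

(** The property of minimizing subgroups that visibly passes to finite
intersections. *)
Definition settled W := compact_open_subgroup W /\
  forall h, W h -> eventual g W h -> forward g W h.

Lemma settledI W W' : settled W -> settled W' -> settled (W `&` W').
Proof.
move=> [cW tW] [cW' tW']; split.
  split; first exact: subgroupI (co_subgroup cW) (co_subgroup cW').
    by apply: compact_closedI; [exact: co_compact|exact: co_closed].
  by apply: openI; exact: co_open.
move=> h [Wh Wh'] Eh n.
split; first by apply: tW => //; apply: eventualS Eh; exact: subIsetl.
by apply: tW' => //; apply: eventualS Eh; exact: subIsetr.
Qed.

Lemma minimizing_settled W : minimizing g W -> settled W.
Proof.
move=> mW; have cW := mW.1; have [U [cU tA tB]] := tidy_exists g cW.
split=> // h Wh Eh.
exact: (tidy_below_eventual (co_subgroup cW) (minimizing_tidy_above mW)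
  (minimizing_tidy_below mW cU tA tB)).
Qed.

Lemma nub_sub_settled O : open O -> nub g `<=` O -> exists2 W, settled W & W `<=` O.
Proof.
move=> oO nubO; have [U [cU tA tB]] := tidy_exists g (cV 0).
have sU : settled U by apply: minimizing_settled; exact: tidy_minimizing.
have /choice[w wP] : forall x, exists W, settled W /\ (~ O x -> ~ W x).
  move=> x; have [Ox|nOx] := pselect (O x); first by exists U.
  apply: contrapT => /forallNP no; apply: nOx; apply: nubO => W mW.
  apply: contrapT => nWx; apply: (no W); split=> //; exact: minimizing_settled.
have cUO : compact (U `&` ~` O).
  apply: compact_closedI; first exact: co_compact.
  by rewrite -openC setCK.
have [x [_ nOx]|F FP] := compact_finite_cover (U := fun x => ~` (w x)) cUO.
  apply: open_nbhs_nbhs; split; last exact: (wP x).2 nOx.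
  by rewrite openC; exact: co_closed (wP x).1.1.
have [W [sW WU Ww]] : exists W, [/\ settled W, W `<=` U &
    forall x, x \in (F : seq G) -> W `<=` w x].
  elim: (F : seq G) => [|x s [W [sW WU Ww]]]; first by exists U; split.
  exists (W `&` w x); split; first exact: settledI (wP x).1.
    by move=> h [/WU].
  by move=> y; rewrite inE => /orP[/eqP ->|/Ww Wy] h [Wh wh] //; exact: Wy.
exists W => // h Wh; apply: contrapT => nOh.
have [x xF] := FP h (conj (WU _ Wh) nOh); apply; exact: Ww Wh.
Qed.

(** In a coset of [W] containing an attracted element y, any other attracted
element differs from y by an element of [W] that never leaves [W]. *)
Lemma settled_uniform W C : settled W -> compact C ->
  exists N : nat, forall n h, (N <= n)%N -> C h -> eventual g W h -> W (conjz g (Posz n) h).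
Proof.
move=> [cW tW] /compact_near_coveringP nc; have sW := co_subgroup cW.
pose P (N : nat) h := eventual g W h -> forall n : nat, (N <= n)%N -> W (conjz g n h).
suff [N _ NP] : \forall N \near \oo, C `<=` P N.
  by exists N => n h Nn Ch Eh; exact: (NP N (leqnn N)).
apply: (nc nat \oo P) => x Cx.
have nx : nbhs x [set y | W (x^-1 * y)%g].
  apply: open_nbhs_nbhs; split; first by apply: open_mull; exact: co_open.
  by rewrite /= mulVg; exact: (subgroup1 sW).
have [[y [Wy [N Ny]]]|no] := pselect (exists y, W (x^-1 * y)%g /\ eventual g W y); last first.
  exists ([set y | W (x^-1 * y)%g], setT) => /=; first by split=> //; exact: filterT.
  by move=> [y N] /= [Wy _] Ey; exfalso; apply: no; exists y.
exists ([set y | W (x^-1 * y)%g], [set n | (N <= n)%N]) => /=.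
  by split=> //; exists N.
move=> [z n] /= [Wz Nn] Ez m nm.
have Wyz : W (y^-1 * z)%g by exact: same_coset Wy Wz.
have Eyz : eventual g W (y^-1 * z)%g.
  have sE := subgroup_eventual g sW; have Ey : eventual g W y by exists N.
  exact: (subgroupM sE (subgroupV sE Ey) Ez).
rewrite -(mulVKg y z) conjzM; apply: (subgroupM sW).
  by apply: Ny; exact: leq_trans nm.
exact: tW.
Qed.

Lemma uniform_of_nub_sub S : nub g `<=` K -> compact_open_subgroup S ->
  uniformly_contracted S.
Proof.
move=> nubK cS r.
have [N tP] := tidy_above_conj_cap g (cV r); have cP := co_conj_cap g N (cV r).
have KP := K_sub_conj_cap (N := N) (@K_sub_V r).
have sP := co_subgroup cP.
have [|W sW WP] := nub_sub_settled (co_open cP); first by move=> h /nubK /KP.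
have [M tQ] := tidy_above_conj_cap g sW.1; have cQ := co_conj_cap g M sW.1.
have cSP : compact (mulset S (core g (conj_cap g (V r) N))).
  by apply: compact_mulset; [exact: co_compact|exact: compact_core].
have [k kP] := settled_uniform sW cSP.
exists k => n h kn Ch Sh; apply: (conj_cap_sub (g := g) (N := N)).
have QP : conj_cap g W M `<=` conj_cap g (V r) N by move=> x /conj_cap_sub /WP.
have [q [l [Eq Cl hE]]] := eventual_decomposition cP cQ QP tQ
  (con_eventual_open (co_open cP) KP Ch).
rewrite hE conjzM; apply: (subgroupM sP); last exact: Cl.
apply: WP; apply: kP => //; last by apply: eventualS Eq; exact: conj_cap_sub.
exists h, l^-1%g; split=> //; last by rewrite hE mulgK.
exact: (subgroupV (subgroup_core g sP) Cl).
Qed.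

End UniformContraction.

(** * From the group to the action *)
Section Action.
Context {R : realType} {X : metricType R} {G : topologicalGroupType}.
Variable act : G -> X -> X.
Hypothesis isom : isometric_action act.
Implicit Types (g h : G) (x y : X) (Y B : set X).

Lemma act1 x : act 1%g x = x. Proof. by case: isom. Qed.
Lemma actM g h x : act (g * h)%g x = act g (act h x). Proof. by case: isom. Qed.
Lemma act_dist g x y : mdist (act g x) (act g y) = mdist x y.
Proof. by case: isom. Qed.
Lemma actK g x : act g^-1%g (act g x) = x.
Proof. by rewrite -actM mulVg act1. Qed.
Lemma actKV g x : act g (act g^-1%g x) = x.
Proof. by rewrite -actM mulgV act1. Qed.

Lemma subgroup_fixator Y : subgroup (fixator act Y).
Proof.
split=> [y _|g h Yg Yh y Yy]; first exact: act1.
by rewrite actM -{1}(Yh y Yy) actK; exact: Yg.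
Qed.

Lemma stabilizerE x : stabilizer act x = fixator act [set x].
Proof. by apply/seteqP; split=> h hx => [y -> //|]; exact: hx. Qed.

Hypothesis ld : locally_discrete_action act.

(** A compact set is covered by finitely many balls with open fixators. *)
Lemma open_fixator Y : (exists2 B, compact B & Y `<=` B) -> open (fixator act Y).
Proof.
move=> [B cB YB]; have /choice[e eP] : forall x, exists e : R,
    (0 < e) /\ open (fixator act (ball x e)).
  by move=> x; have [e e0 oe] := ld x; exists e.
have [x _|F FP] := compact_finite_cover (U := fun x => ball x (e x)) cB.
  by apply: nbhsx_ballx; exact: (eP x).1.
have [U [sU oU UF]] : exists U, [/\ subgroup U, open U &
    forall x, x \in (F : seq X) -> U `<=` fixator act (ball x (e x))].
  elim: (F : seq X) => [|x s [U [sU oU Us]]].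
    by exists setT; split=> //; exact: openT.
  exists (U `&` fixator act (ball x (e x))); split.
  - by apply: subgroupI => //; exact: subgroup_fixator.
  - by apply: openI => //; exact: (eP x).2.
  - by move=> y; rewrite inE => /orP[/eqP ->|/Us Uy] h [Uh xh] //; exact: Uy.
apply: (open_superset (subgroup_fixator Y) sU oU) => h Uh y /YB By.
by have [x xF xy] := FP y By; exact: (UF x xF h Uh).
Qed.

Hypothesis act_proper : proper_action act.

Lemma co_fixator Y : Y !=set0 -> (exists2 B, compact B & Y `<=` B) ->
  compact_open_subgroup (fixator act Y).
Proof.
move=> [y Yy] cY; split; [exact: subgroup_fixator| |exact: open_fixator].
apply: (subclosed_compact _ (@act_proper y 0)).
  by apply: open_subgroup_closed; [exact: subgroup_fixator|exact: open_fixator].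
move=> h hY; apply: subset_closure; rewrite /= hY //.
by rewrite mdistxx.
Qed.

Lemma co_stabilizer x : compact_open_subgroup (stabilizer act x).
Proof.
rewrite stabilizerE; apply: co_fixator; first by exists x.
by exists [set x] => //; exact: compact_set1.
Qed.

Hypothesis X_proper : proper_space X.
Variables (g : G) (Y : set X) (y0 : X).
Hypothesis Yy0 : Y y0.
Hypothesis Y_inv : act g @` Y = Y.

(** The subgroups V_r: they decrease to the fixator of [Y]. *)
Definition ball_fixator (r : nat) : set G :=
  fixator act (Y `&` [set y | mdist y0 y <= r%:R]).

Lemma co_ball_fixator r : compact_open_subgroup (ball_fixator r).
Proof.
apply: co_fixator; first by exists y0; split=> //=; rewrite mdistxx.
by exists [set y | mdist y0 y <= r%:R] => [|y []].
Qed.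

Lemma ball_fixatorS r : ball_fixator r.+1 `<=` ball_fixator r.
Proof.
move=> h hr y [Yy yr]; apply: hr; split=> //=.
by apply: le_trans yr _; rewrite ler_nat.
Qed.

Lemma bigcap_ball_fixator : fixator act Y = \bigcap_r ball_fixator r.
Proof.
apply/seteqP; split=> [h hY r _ y [Yy _]|h hY y Yy]; first exact: hY.
apply: (hY (Num.truncn (mdist y0 y)).+1 I); split=> //=.
by apply/ltW; rewrite truncnS_gt.
Qed.

Lemma act_zexpg_inv z y : Y y -> Y (act (zexpg g z) y).
Proof.
have Yg n u : Y u -> Y (act (g ^+ n)%g u).
  elim: n => [|n IH] Yu; first by rewrite expg0 act1.
  by rewrite expgS actM -Y_inv; exists (act (g ^+ n)%g u) => //; exact: IH.
have YgV n u : Y u -> Y (act (g ^- n)%g u).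
  elim: n u => [|n IH] u Yu; first by rewrite expg0 invg1 act1.
  rewrite expgS invgM actM; apply: IH.
  by move: Yu; rewrite -{1}Y_inv => -[v Yv <-]; rewrite actK.
by case: z => n /=; [exact: Yg|exact: YgV].
Qed.

Lemma fixator_inv z h : fixator act Y h -> fixator act Y (conjz g z h).
Proof.
move=> hY y Yy; rewrite conjz_def 2!actM hY ?actKV //.
by rewrite -zexpgN; exact: act_zexpg_inv.
Qed.

(** Conjugating by [g] moves the ball about the base point to one about its
image, and [Y] is invariant. *)
Lemma ball_fixator_conjz r n h : ball_fixator r (conjz g (Posz n) h) <->
  forall y, Y y -> mdist (act (g ^- n)%g y0) y <= r%:R -> act h y = y.
Proof.
rewrite conjzE; split=> [hr y Yy yr|hr y [Yy /= yr]].
  have Byn : (Y `&` [set y | mdist y0 y <= r%:R]) (act (g ^+ n)%g y).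
    split; first exact: (act_zexpg_inv (Posz n)).
    by rewrite /= -{1}(actKV (g ^+ n)%g y0) act_dist.
  have := hr _ Byn.
  by rewrite 2!actM actK => /(congr1 (act (g ^- n)%g)); rewrite !actK.
rewrite 2!actM hr ?actKV //; last by rewrite act_dist.
by rewrite -[(g ^- n)%g](zexpgN g n); exact: act_zexpg_inv.
Qed.

Variables (xi : set (R -> X)) (c : R -> X) (k M : R).
Hypothesis xi_bd : boundary xi.
Hypothesis xic : xi c.
Hypothesis k0 : 0 < k.
Hypothesis track : forall n : nat, mdist (act (g ^- n)%g y0) (c (k * n%:R)) <= M.

Let K := fixator act Y.

Lemma absorbing_uniform x :
  absorbing Y xi (fixed_points act (con g K `&` stabilizer act x)) ->
  uniformly_contracted g K ball_fixator (stabilizer act x).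
Proof.
move=> ab r; have [rho rho_oo near_sub] := absorbing_all xi_bd ab xic.
have /cvgryPge/(_ (r%:R + M)) near_rho := rho_oo.
have [T [Tr TP]] : \forall t \near +oo, r%:R + M <= rho t /\
    [set y | Y y /\ mdist (c t) y <= rho t] `<=`
      fixed_points act (con g K `&` stabilizer act x).
  by near=> t; split; near: t.
exists (Num.truncn (T / k)).+1 => n h Tn ch hx; apply/ball_fixator_conjz => y Yy yr.
have Tkn : T < k * n%:R.
  rewrite mulrC -ltr_pdivrMr //; apply: lt_le_trans (_ : (Num.truncn (T / k)).+1%:R <= _).
    by rewrite truncnS_gt.
  by rewrite ler_nat.
have [rk sub] := TP _ Tkn; apply: (sub y) => //; split=> //.
apply: le_trans rk; apply: le_trans (metric_triangle _ (act (g ^- n)%g y0) _) _.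
by rewrite metric_sym addrC; exact: lerD.
Unshelve. all: by end_near.
Qed.

(** The radius at time t is taken just below the supremum of the radii that work,
truncated at t so that the supremum is finite; the uniform bounds make it tend
to infinity. *)
Lemma uniform_absorbing x : geodesic_ray c ->
  uniformly_contracted g K ball_fixator (stabilizer act x) ->
  absorbing Y xi (fixed_points act (con g K `&` stabilizer act x)).
Proof.
move=> cray unif; set Z := fixed_points act _.
pose S t := [set s : R | s <= t /\ [set y | Y y /\ mdist (c t) y <= s] `<=` Z].
have S1 t : 0 <= t -> S t (-1).
  move=> t0; split; first by lra.
  by move=> y [_ yc]; have := le_trans (mdist_ge0 (c t) y) yc; lra.
have supS t : 0 <= t -> has_sup (S t).
  by move=> t0; split; [exists (-1); exact: S1|exists t => s []].
have M0 : 0 <= M by apply: le_trans (track 0); exact: mdist_ge0.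
have bigS (r : nat) : \forall t \near +oo, S t r%:R.
  have [N NP] := unif (Num.truncn (r%:R + M + k)).+1.
  near=> t; have t0 : 0 <= t by near: t; exact: (nbhs_pinfty_ge (num_real _)).
  have tN : N%:R * k <= t by near: t; exact: (nbhs_pinfty_ge (num_real _)).
  split; first by near: t; exact: (nbhs_pinfty_ge (num_real _)).
  move=> y [Yy yr] h [ch hx]; pose n := Num.truncn (t / k).
  have tk0 : 0 <= t / k by rewrite divr_ge0 // ltW.
  have /andP[nt tn] : n%:R <= t / k < n.+1%:R by rewrite /n truncn_itv.
  have Nn : (N <= n)%N.
    suff : (N%:R : R) < n.+1%:R by rewrite ltr_nat ltnS.
    by apply: le_lt_trans tn; rewrite ler_pdivlMr.
  have /ball_fixator_conjz := NP n h Nn ch hx; apply => //.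
  apply: (@le_trans _ _ (r%:R + M + k)); last by apply/ltW; rewrite truncnS_gt.
  have knt : k * n%:R <= t by rewrite mulrC -ler_pdivlMr.
  have tkn : t <= k * n%:R + k.
    apply/ltW; rewrite ltr_pdivrMr // in tn.
    by rewrite -{2}(mulr1 k) -mulrDr mulrC; rewrite -natr1 in tn.
  have ct : mdist (c (k * n%:R)) (c t) <= k.
    rewrite cray //; last by rewrite mulr_ge0 // ltW.
    by rewrite distrC ger0_norm ?subr_ge0 // lerBlDl.
  apply: le_trans (metric_triangle _ (c t) _) _.
  rewrite -addrA addrC; apply: lerD => //.
  apply: le_trans (metric_triangle _ (c (k * n%:R)) _) _.
  exact: lerD.
exists c => //; exists (fun t => sup (S t) - 1).
  apply/cvgryPge => A; have := bigS (Num.truncn (A + 1)).+1.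
  apply: filterS2 (nbhs_pinfty_ge (num_real (0 : R))) => t t0 St.
  rewrite lerBrDr; apply: le_trans (ub_le_sup (supS t t0).2 St).
  by apply/ltW; rewrite truncnS_gt.
near=> t; have t0 : 0 <= t by near: t; exact: (nbhs_pinfty_ge (num_real _)).
move=> y [Yy yt]; have [s [_ sZ] ls] := sup_adherent ltr01 (supS t t0).
by apply: sZ; split=> //; apply: le_trans yt _; exact: ltW.
Unshelve. all: by end_near.
Qed.

End Action.

(** * Geodesics and triangles *)
Section Geodesics.
Context {R : realType} {X : metricType R}.
Implicit Types (x y z p q o : X) (c : R -> X).
Local Notation d := mdist.

Lemma geodesic_rev x y c : geodesic_segment x y c ->
  geodesic_segment y x (fun t => c (d x y - t)).
Proof.
move=> [c0 c1 cd]; split; [by rewrite subr0|by rewrite metric_sym subrr|].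
move=> s t; rewrite !in_itv /= => /andP[s0 s1] /andP[t0 t1].
rewrite metric_sym in s1 t1.
rewrite cd ?in_itv /=; [|by apply/andP; split; lra..].
by rewrite distrC; congr (`|_|); ring.
Qed.

Lemma ray_segment c r : geodesic_ray c -> 0 <= r -> geodesic_segment (c 0) (c r) c.
Proof.
move=> cr r0; have dr : d (c 0) (c r) = r by rewrite cr // sub0r normrN ger0_norm.
split; rewrite ?dr // => s t; rewrite !in_itv /= => /andP[s0 _] /andP[t0 _].
exact: cr.
Qed.

Lemma ray_dist c s t : geodesic_ray c -> 0 <= s -> s <= t -> d (c s) (c t) = t - s.
Proof.
move=> cr s0 st; rewrite cr //; last exact: le_trans st.
by rewrite distrC ger0_norm // subr_ge0.
Qed.

Lemma segment_dist x y c s t : geodesic_segment x y c ->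
  0 <= s -> s <= t -> t <= d x y -> d (c s) (c t) = t - s.
Proof.
move=> [_ _ cd] s0 st tl; rewrite cd ?in_itv /=; last 2 first.
- by apply/andP; split; lra.
- by apply/andP; split; lra.
by rewrite distrC ger0_norm // subr_ge0.
Qed.

Definition cyc3 (T : Type) (a b e : T) : 'I_3 -> T :=
  fun i => match nat_of_ord i with 0 => a | 1 => b | _ => e end.

Lemma I3_ind (P : 'I_3 -> Prop) : P 0 -> P 1 -> P (1 + 1) -> forall i, P i.
Proof.
move=> P0 P1 P2 [[|[|[|//]]] i3].
- by have <- : 0 = Ordinal i3 :> 'I_3 by exact: val_inj.
- by have <- : 1 = Ordinal i3 :> 'I_3 by exact: val_inj.
- by have <- : 1 + 1 = Ordinal i3 :> 'I_3 by exact: val_inj.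
Qed.

Lemma I3_next : (1 + 1 + 1 : 'I_3) = 0.
Proof. exact: val_inj. Qed.

Lemma cyc3_triangle x y z c0 c1 c2 : geodesic_segment x y c0 ->
  geodesic_segment y z c1 -> geodesic_segment z x c2 ->
  geodesic_triangle (cyc3 x y z) (cyc3 c0 c1 c2).
Proof. by move=> g0 g1 g2; apply: I3_ind; rewrite ?add0r ?I3_next. Qed.

End Geodesics.

(** * Rays in CAT(0) spaces *)
Section CAT0.
Context {R : realType} {X : metricType R}.
Implicit Types (x y z p q o : X) (c : R -> X).
Local Notation d := mdist.

Lemma plane_distE (p q : R * R) (z : R) : 0 <= z ->
  (p.1 - q.1) ^+ 2 + (p.2 - q.2) ^+ 2 = z ^+ 2 -> plane_dist p q = z.
Proof. by move=> z0 e; rewrite /plane_dist e sqrtr_sqr ger0_norm. Qed.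

(** A comparison triangle is placed with vertices (0,0), (a,0) and (u,v); the
triangle inequalities bound u by b in absolute value. *)
Lemma comparison_vertex (a b e : R) : 0 <= a -> 0 <= b -> 0 <= e ->
  e <= a + b -> a <= b + e -> b <= a + e ->
  exists u v, u ^+ 2 + v ^+ 2 = b ^+ 2 /\ (a - u) ^+ 2 + v ^+ 2 = e ^+ 2.
Proof.
move=> a0 b0 e0 eab abe bae.
have [az|ap] : a = 0 \/ 0 < a by case: (ltgtP a 0) => [|//|->]; [lra|right|left].
  by exists b, 0; have -> : e = b by [lra]; split; rewrite ?az; ring.
pose u := (a ^+ 2 + b ^+ 2 - e ^+ 2) / (2 * a).
have uE : 2 * a * u = a ^+ 2 + b ^+ 2 - e ^+ 2.
  by rewrite /u mulrC divfK // mulf_neq0 // ?pnatr_eq0 // gt_eqF.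
have ub : u <= b.
  rewrite -(ler_pM2l (_ : 0 < 2 * a)); last by lra.
  by rewrite uE; nra.
have bu : - b <= u.
  rewrite -(ler_pM2l (_ : 0 < 2 * a)); last by lra.
  by rewrite uE; nra.
have ub2 : 0 <= b ^+ 2 - u ^+ 2 by nra.
exists u, (Num.sqrt (b ^+ 2 - u ^+ 2)); rewrite sqr_sqrtr //.
by split; [ring|lra].
Qed.

Hypothesis cat0 : CAT0_space X.

(** Comparison points at the same ratio of the sides issuing from [p] are the
images of the opposite vertices under a homothety of the plane. *)
Lemma CAT0_contraction p q1 q2 c1 c2 (l : R) :
  geodesic_segment p q1 c1 -> geodesic_segment p q2 c2 -> 0 <= l <= 1 ->
  d (c1 (l * d p q1)) (c2 (l * d p q2)) <= l * d q1 q2.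
Proof.
move=> g1 g2 /andP[l0 l1]; have [geo tri] := cat0.
have [c3 g3] := geo q1 q2.
have := tri _ _ (cyc3_triangle g1 g3 (geodesic_rev g2)).
set a := d p q1; set b := d p q2; set e := d q1 q2.
have a0 : 0 <= a := mdist_ge0 _ _; have b0 : 0 <= b := mdist_ge0 _ _.
have e0 : 0 <= e := mdist_ge0 _ _.
have [||||||u [v [uv auv]]] := @comparison_vertex a b e => //.
- by rewrite /e (le_trans (metric_triangle _ p _)) // (metric_sym q1 p).
- by rewrite /e metric_sym; exact: metric_triangle.
- exact: metric_triangle.
pose w := cyc3 (0, 0) (a, 0) (u, v).
have wE : comparison_triangle (cyc3 p q1 q2) w.
  apply: I3_ind; rewrite ?add0r ?I3_next /side_length /w /cyc3 /=.
  - by apply: plane_distE => //=; rewrite -/a; ring.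
  - by rewrite -/e; apply: plane_distE => //=; rewrite -auv; ring.
  - by rewrite (metric_sym q2 p) -/b; apply: plane_distE => //=; rewrite -uv; ring.
pose P := (l * a, 0 : R); pose Q := (l * u, l * v).
move=> /(_ w wE 0 (1 + 1) (l * a) ((1 - l) * b) P Q).
rewrite /side_length add0r I3_next /cyc3 /= -/a (metric_sym q2 p) -/b !in_itv /=.
have -> : b - (1 - l) * b = l * b by ring.
have -> : plane_dist P Q = l * e.
  by apply: plane_distE => /=; [exact: mulr_ge0|rewrite exprMn -auv; ring].
apply.
- by apply/andP; split; nra.
- by apply/andP; split; nra.
- split; rewrite ?add0r /w /cyc3 /=.
    by apply: plane_distE => /=; [exact: mulr_ge0|ring].
  rewrite (@plane_distE (0, 0) (a, 0) a) //=; last by ring.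
  apply: plane_distE => /=; [nra|ring].
- split; rewrite ?I3_next /w /cyc3 /=.
    by apply: plane_distE => /=; [nra|rewrite exprMn -uv; ring].
  rewrite (@plane_distE (u, v) (0, 0) b) //=; last by rewrite -uv; ring.
  apply: plane_distE => /=; [nra|].
  have -> : b - (1 - l) * b = l * b by ring.
  by rewrite exprMn -uv; ring.
Qed.

Variables (u : nat -> X) (c' : R -> X) (k M : R).
Hypothesis ray' : geodesic_ray c'.
Hypothesis k0 : 0 < k.
Hypothesis track : forall n : nat, d (u n) (c' (k * n%:R)) <= M.

(** The segment from [c 0] to [u n] and the ray [c] end within a bounded distance
of each other, at a distance L from [c 0]; at time r they are then within a
multiple of r / L, by [CAT0_contraction]. *)
Lemma cvg_cone_tracking : cvg_cone u (ray_class c').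
Proof.
move=> c [cr [M1 cM1]] r e r0 e0; pose M' := M + M1.
have kn0 n : 0 <= k * n%:R by rewrite mulr_ge0 // ltW.
have uc n : d (u n) (c (k * n%:R)) <= M'.
  exact: le_trans (metric_triangle _ (c' (k * n%:R)) _) (lerD (track n) (cM1 _ (kn0 n))).
have M'0 : 0 <= M' := le_trans (mdist_ge0 _ _) (uc 0%N).
pose B := M' + r + 2 * r * M' / e.
exists (Num.truncn (B / k)).+1 => // n /= Nn.
have Bkn : B < k * n%:R.
  rewrite mulrC -ltr_pdivrMr //; apply: lt_le_trans (_ : (Num.truncn (B / k)).+1%:R <= _).
    by rewrite truncnS_gt.
  by rewrite ler_nat.
have rM0 : 0 <= 2 * r * M' / e by rewrite divr_ge0 ?(ltW e0) //; nra.
set L := d (c 0) (u n); set l := k * n%:R in Bkn *.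
have l0 : 0 <= l := kn0 n.
have cl : d (c 0) (c l) = l by rewrite ray_dist ?subr0.
have lL : l - M' <= L.
  have := metric_triangle (c 0) (u n) (c l); rewrite cl -/L.
  by have := uc n; rewrite -/l; lra.
have Ll : L <= l + M'.
  have := metric_triangle (c 0) (c l) (u n); rewrite cl -/L (metric_sym (c l)).
  by have := uc n; rewrite -/l; lra.
have BL : r + 2 * r * M' / e < L by rewrite /B in Bkn; lra.
have rL : r < L by lra.
split=> // s gs; have L0 : 0 < L by lra.
have := CAT0_contraction gs (ray_segment cr (kn0 n)) (l := r / L).
rewrite -/l cl -/L divfK ?gt_eqF //.
have rL1 : 0 <= r / L <= 1 by rewrite divr_ge0 ?(ltW r0, ltW L0) //= ler_pdivrMr // mul1r ltW.
move=> /(_ rL1) sr.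
have cc : d (c (r / L * l)) (c r) <= r / L * M'.
  rewrite cr; [|by rewrite mulr_ge0 //; case/andP: rL1|exact: ltW].
  have -> : r / L * l - r = r / L * (l - L) by rewrite mulrBr divfK ?gt_eqF.
  rewrite normrM (ger0_norm (_ : 0 <= r / L)); last by case/andP: rL1.
  apply: ler_wpM2l; first by case/andP: rL1.
  by rewrite ler_norml; apply/andP; split; lra.
have uc' : r / L * d (u n) (c l) <= r / L * M'.
  by apply: ler_wpM2l; [case/andP: rL1|exact: uc].
apply: le_lt_trans (metric_triangle _ (c (r / L * l)) _) _.
apply: (@le_lt_trans _ _ (2 * r * M' / L)).
  have -> : 2 * r * M' / L = r / L * M' + r / L * M' by ring.
  exact: lerD (le_trans sr uc') cc.
have : 2 * r * M' / e < L by lra.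
by rewrite !ltr_pdivrMr // [e * L]mulrC.
Qed.

(** Applied at the far end point, [CAT0_contraction] keeps the segments from
[c 0] to points of [c'] within twice the distance of the origins from [c'], and
these segments converge to [c]. *)
Lemma cvg_cone_asymptotic c : geodesic_ray c ->
  cvg_cone (fun n => c' (k * n%:R)) (ray_class c) -> asymptotic c c'.
Proof.
move=> cr cv; pose D := d (c 0) (c' 0).
exists (1 + D + D) => r; rewrite le_eqVlt => /orP[/eqP <-|r0].
  by have : 0 <= D := mdist_ge0 _ _; rewrite -/D; lra.
have cc : ray_class c c by split=> //; exists 0 => t _; rewrite mdistxx.
have [N _ /(_ N (leqnn N)) /= [rL sc]] := cv c cc r 1 r0 ltr01.
set q := c' (k * N%:R) in rL sc; set l := k * N%:R in q rL sc.
have l0 : 0 <= l by rewrite mulr_ge0 // ltW.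
have [s gs] := cat0.1 (c 0) q; have sr := sc s gs.
set L := d (c 0) q in rL.
have cl : d (c' 0) q = l by rewrite /q ray_dist ?subr0.
have L0 : 0 < L := lt_trans r0 rL.
have rL1 : 0 <= r / L <= 1 by rewrite divr_ge0 ?(ltW r0, ltW L0) //= ler_pdivrMr // mul1r ltW.
have lam : 0 <= 1 - r / L <= 1 by apply/andP; case/andP: rL1 => *; split; lra.
have := CAT0_contraction (geodesic_rev gs) (geodesic_rev (ray_segment ray' l0)) lam.
rewrite -/q cl (metric_sym q) -/L (metric_sym q) cl -/D.
have -> : L - (1 - r / L) * L = r.
  by rewrite mulrBl mul1r divfK ?gt_eqF // opprB addrC subrK.
have -> : l - (1 - r / L) * l = r / L * l by ring.
have D0 : 0 <= D := mdist_ge0 _ _.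
have : (1 - r / L) * D <= D by case/andP: lam => *; nra.
have : d (c' (r / L * l)) (c' r) <= D.
  have rl0 : 0 <= r / L * l by apply: mulr_ge0 => //; case/andP: rL1.
  rewrite (ray' rl0 (ltW r0)).
  have -> : r / L * l - r = r / L * (l - L) by rewrite mulrBr divfK ?gt_eqF.
  rewrite normrM (ger0_norm (_ : 0 <= r / L)); last by case/andP: rL1.
  have lL : `|l - L| <= D.
    rewrite ler_norml; apply/andP; split.
      by have := metric_triangle (c 0) (c' 0) q; rewrite cl -/L -/D; lra.
    by have := metric_triangle (c' 0) (c 0) q; rewrite cl -/L (metric_sym (c' 0)) -/D; lra.
  by case/andP: rL1 => *; have := normr_ge0 (l - L); nra.
move=> h1 h2 h3.
have := metric_triangle (c r) (s r) (c' r).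
have := metric_triangle (s r) (c' (r / L * l)) (c' r).
by rewrite (metric_sym (c r) (s r)); lra.
Qed.

End CAT0.

(** * Thin triangles and the four point inequality *)
Section ThinTriangles.
Context {R : realType} {X : metricType R}.
Implicit Types (x y z p q o : X) (c : R -> X).
Local Notation d := mdist.
Local Notation gp := gromov_product.

Lemma gpC o x y : gp o x y = gp o y x.
Proof. by rewrite /gromov_product [d x y]metric_sym [d x o + _]addrC. Qed.

Lemma gp_le_between o x y q : d x q + d q y = d x y -> gp o x y <= d o q.
Proof.
move=> e; rewrite /gromov_product -e ler_pdivrMr //.
have := metric_triangle x q o; have := metric_triangle y q o.
by rewrite (metric_sym y q) (metric_sym q o); lra.
Qed.

Variable delta : R.
Hypothesis delta0 : 0 <= delta.
Hypothesis hyp : hyperbolic_space X delta.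

Lemma thin3 x y z c0 c1 c2 s : geodesic_segment x y c0 ->
  geodesic_segment y z c1 -> geodesic_segment z x c2 -> 0 <= s <= d x y ->
  (exists t, 0 <= t <= d y z /\ d (c0 s) (c1 t) <= delta) \/
  (exists t, 0 <= t <= d z x /\ d (c0 s) (c2 t) <= delta).
Proof.
move=> g0 g1 g2 sxy.
have := hyp.2 _ _ (cyc3_triangle g0 g1 g2) 0 s.
rewrite /side_length add0r /cyc3 /= in_itv /= => /(_ sxy) [j].
elim/I3_ind: j => [[t []] //|[t [_]]|[t [_]]]; rewrite ?I3_next in_itv /= => t01 le_d.
- by left; exists t.
- by right; exists t.
Qed.

(** Points of the side [x, y] near the start are close to the side [o, x], those
near the end are close to [y, o]; at the last point of the first kind both hold,
up to an additive constant coming from the choice of points near a supremum. *)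
Lemma gp_ge_near o x y c : geodesic_segment x y c ->
  exists s, 0 <= s <= d x y /\ d o (c s) <= gp o x y + (2 * delta + 1).
Proof.
move=> g0; have [a1 g1] := hyp.1 y o; have [a2 g2] := hyp.1 o x.
have [cx cy _] := g0; have [a1y a1o _] := g1; have [a2o a2x _] := g2.
pose S := [set s | 0 <= s <= d x y /\
  exists t, 0 <= t <= d o x /\ d (c s) (a2 t) <= delta].
have S0 : S 0.
  split; first by rewrite lexx mdist_ge0.
  by exists (d o x); rewrite lexx mdist_ge0 cx a2x mdistxx.
have supS : has_sup S by split; [exists 0|exists (d x y) => s [/andP[]]].
have S0sup : 0 <= sup S := ub_le_sup supS.2 S0.
have Sxy : sup S <= d x y by apply: ge_sup; [exists 0|move=> s [/andP[]]].
have half : 0 < (1 / 2 : R) by lra.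
have [s1 [s1xy [t [tox s1t]]] s1S] := sup_adherent half supS.
have [s1ge s1le] := andP s1xy; have [t0 tl] := andP tox.
have le_s1 : s1 <= sup S by apply: (ub_le_sup supS.2); split=> //; exists t.
have [s2 [s2xy s12 [t' [t'yo s2t']]]] : exists s2, [/\ 0 <= s2 <= d x y,
    s1 <= s2 <= s1 + 1 & exists t, 0 <= t <= d y o /\ d (c s2) (a1 t) <= delta].
  have [big|small] := leP (d x y) (sup S + 1 / 2).
    exists (d x y); split; first by rewrite lexx mdist_ge0.
      by apply/andP; split; lra.
    by exists 0; rewrite lexx mdist_ge0 cy a1y mdistxx.
  have s2xy : 0 <= sup S + 1 / 2 <= d x y by apply/andP; split; lra.
  exists (sup S + 1 / 2); split=> //; first by apply/andP; split; lra.
  have [//|[t2 t2P]] := thin3 g0 g1 g2 s2xy.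
  have : sup S + 1 / 2 <= sup S by apply: (ub_le_sup supS.2); split=> //; exists t2.
  by lra.
have [s2ge s2le] := andP s2xy; have [s12a s12b] := andP s12; have [t'0 t'l] := andP t'yo.
exists s1; split=> //.
have e1 : d (c s1) (c s2) = s2 - s1 by exact: segment_dist g0 s1ge s12a s2le.
have e2 : d o (a2 t) = t by rewrite -{1}a2o (segment_dist g2) ?subr0.
have e3 : d (a2 t) x = d o x - t by rewrite -{1}a2x (segment_dist g2).
have e4 : d y (a1 t') = t' by rewrite -{1}a1y (segment_dist g1) ?subr0.
have e5 : d (a1 t') o = d y o - t' by rewrite -{1}a1o (segment_dist g1).
have e6 : d x (c s1) = s1 by rewrite -{1}cx (segment_dist g0) ?subr0.
have e7 : d (c s1) y = d x y - s1 by rewrite -{1}cy (segment_dist g0).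
have h1 := metric_triangle o (a2 t) (c s1).
have h2 := metric_triangle (c s1) (a2 t) x.
have h3 := metric_triangle (c s1) (c s2) (a1 t').
have h4 := metric_triangle o (a1 t') (c s1).
have h5 := metric_triangle (c s1) (a1 t') y.
have s1t' := s1t; rewrite metric_sym in s1t'.
rewrite (metric_sym (a1 t') y) e4 in h5.
rewrite (metric_sym o (a1 t')) e5 (metric_sym (a1 t') (c s1)) in h4.
rewrite (metric_sym (c s1) x) e6 in h2.
rewrite /gromov_product (metric_sym x o).
rewrite -lerBlDr ler_pdivlMr //; lra.
Qed.

(** The point of [x, z] given by [gp_ge_near] is close to one of the other two
sides of the triangle x, y, z, and its distance to [o] bounds the Gromov product
of the ends of that side by [gp_le_between]. *)
Lemma four_point o x y z :
  gp o x y <= gp o x z + (3 * delta + 1) \/ gp o y z <= gp o x z + (3 * delta + 1).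
Proof.
have [c0 g0] := hyp.1 x z; have [c1 g1] := hyp.1 z y; have [c2 g2] := hyp.1 y x.
have [s [sxz os]] := gp_ge_near o g0.
have [[t [/andP[t0 tl] st]]|[t [/andP[t0 tl] st]]] := thin3 g0 g1 g2 sxz.
- right; have [cz cy _] := g1.
  have : gp o z y <= d o (c1 t).
    apply: gp_le_between; rewrite -{1}cz -{1}cy.
    by rewrite (segment_dist g1) // (segment_dist g1) //; ring.
  by rewrite gpC; have := metric_triangle o (c0 s) (c1 t); lra.
- left; have [cy cx _] := g2.
  have : gp o y x <= d o (c2 t).
    apply: gp_le_between; rewrite -{1}cy -{1}cx.
    by rewrite (segment_dist g2) // (segment_dist g2) //; ring.
  by rewrite gpC; have := metric_triangle o (c0 s) (c2 t); lra.
Qed.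

Lemma four_point_dist x y z o :
  d x z + d y o <= d x y + d z o + 2 * (3 * delta + 1) \/
  d x z + d y o <= d x o + d y z + 2 * (3 * delta + 1).
Proof.
have [h|h] := four_point o x y z; rewrite /gromov_product in h.
- left; rewrite -lerBlDr ler_pdivlMr // mulrBl divfK ?pnatr_eq0 // in h.
  lra.
- right; rewrite -lerBlDr ler_pdivlMr // mulrBl divfK ?pnatr_eq0 // in h.
  lra.
Qed.

End ThinTriangles.


(** * Orbits of hyperbolic isometries are rough geodesics *)
Section RoughGeodesic.
Context {R : realType} {X : metricType R}.
Local Notation d := mdist.
Variables (u : nat -> X) (a : nat -> R) (e : R).
Hypothesis e0 : 0 <= e.
Hypothesis four : forall x y z o : X,
  d x z + d y o <= d x y + d z o + e \/ d x z + d y o <= d x o + d y z + e.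
Hypothesis ua : forall m n, (m <= n)%N -> d (u m) (u n) = a (n - m)%N.

Lemma growth_ge0 n : 0 <= a n.
Proof. by rewrite -[n]subn0 -ua //; exact: mdist_ge0. Qed.

Lemma growth0 : a 0%N = 0.
Proof. by rewrite -(subnn 0) -ua // mdistxx. Qed.

Lemma growthD m n : a (m + n)%N <= a m + a n.
Proof.
have := metric_triangle (u 0%N) (u m) (u (m + n)%N).
by rewrite !ua ?leq_addr // !subn0 addKn.
Qed.

Lemma growthM m n : a (m * n)%N <= m%:R * a n.
Proof.
elim: m => [|m IH]; first by rewrite mul0n growth0 mul0r.
by rewrite mulSn -natr1 mulrDl mul1r; have := growthD n (m * n); lra.
Qed.

Lemma growth_dist n l : d (u n) (u (n + l)%N) = a l.
Proof. by rewrite ua ?leq_addr // addKn. Qed.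

Lemma growth_dist0 n : d (u 0%N) (u n) = a n.
Proof. exact: (growth_dist 0). Qed.

Lemma growthB j l : a j <= a (j + l)%N + a l.
Proof.
have := metric_triangle (u 0%N) (u (j + l)%N) (u j).
by rewrite (metric_sym (u (j + l)%N)) (growth_dist j l) !growth_dist0.
Qed.

(** The four point inequality for the points at times 0, n, n + l and 2n + l. *)
Lemma growth_four n l :
  (2 * a (n + l)%N <= 2 * a n + e \/ 2 * a (n + l)%N <= a (n + l + n)%N + a l + e) /\
  (2 * a n <= 2 * a (n + l)%N + e \/ 2 * a n <= a (n + l + n)%N + a l + e).
Proof.
have h2 : d (u n) (u (n + l + n)%N) = a (n + l)%N by rewrite -addnA growth_dist addnC.
have h4 := growth_dist (n + l) n; have h6 := growth_dist n l.
split.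
- have := four (u 0%N) (u n) (u (n + l)%N) (u (n + l + n)%N).
  by rewrite !growth_dist0 h2 h4 h6 => -[h|h]; [left|right]; lra.
- have := four (u 0%N) (u (n + l)%N) (u n) (u (n + l + n)%N).
  rewrite (metric_sym (u (n + l)%N) (u n)) !growth_dist0 h2 h4 h6.
  by move=> [h|h]; [left|right]; lra.
Qed.

(** If the value at p + k were not smaller than those at p and p + 2k by more
than [e], the four point inequality for the origin and u(p), u(p+k), u(p+2k)
would bound a(2k) by a(k) + 2e. *)
Lemma growth_gap p k : a k + 2 * e < a (k + k)%N ->
  a (p + k)%N + e < a (p + k + k)%N \/ a (p + k)%N + e < a p.
Proof.
move=> gap; have := four (u (p + k + k)%N) (u (p + k)%N) (u p) (u 0%N).
have dC n l : d (u (n + l)%N) (u n) = a l by rewrite metric_sym growth_dist.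
have dC0 n : d (u n) (u 0%N) = a n by rewrite metric_sym growth_dist0.
have e1 : d (u (p + k + k)%N) (u p) = a (k + k)%N by rewrite -addnA dC.
rewrite e1 !dC0 !dC.
by move=> [h|h]; [right|left]; lra.
Qed.

(** [growth_four] with two times that differ by the constant [k] or 2[k], and at
which [growth_gap] makes the values of [a] differ, excludes the trivial
alternative and bounds a(m) by half of a(2m), up to a constant. *)
Lemma growth_doubling k : a k + 2 * e < a (k + k)%N ->
  exists C, forall m, 2 * a m <= a (m + m)%N + C.
Proof.
move=> gap.
exists (2 * ((k + k)%:R * a 1%N) + 2 * a k + 2 * a (k + k)%N + a (k + k + k)%N + e) => m.
have e0' := e0; have ak := growth_ge0 k; have ak2 := growth_ge0 (k + k)%N.
have ak3 := growth_ge0 (k + k + k)%N; have a1 := growth_ge0 1%N.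
have kk : 0 <= (k + k)%:R * a 1%N by rewrite mulr_ge0.
set b1 := _%:R * a 1%N in kk *.
have [small|big] := ltnP m (k + k).
  have mb : m%:R * a 1%N <= b1 by rewrite ler_wpM2r // ler_nat ltnW.
  have am := le_trans (growthM m 1) mb; rewrite muln1 in am.
  by have am2 := growth_ge0 (m + m)%N; lra.
have [p ->] : exists p, m = (p + k + k)%N.
  by exists (m - (k + k))%N; rewrite -addnA subnK.
have [h|h] := growth_gap p gap.
- have [[g|g] _] := growth_four (p + k) k; first by lra.
  have := growthB (p + k + k + (p + k)) k; rewrite -(addnA (p + k + k)).
  by lra.
- have [_ [g|g]] := growth_four p k; first by lra.
  have h1 := growthB (p + k + p) (k + k + k).
  have E : (p + k + p + (k + k + k) = p + k + k + (p + k + k))%N by ring.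
  rewrite E in h1; have := growthD p (k + k); rewrite addnA.
  by lra.
Qed.

Variables (L A : R).
Hypothesis L0 : 0 < L.
Hypothesis lower : forall n, n%:R / L - A <= a n.

(** Otherwise [a] would grow at most linearly in j along the powers 2^j, against
its linear lower bound; the witness used is the even exponent 2i, for which 2^(2i)
exceeds i^2. *)
Lemma growth_gap_exists : exists k, a k + 2 * e < a (k + k)%N.
Proof.
apply: contrapT => /forallNP no.
have slow k : a (k + k)%N <= a k + 2 * e by rewrite leNgt; apply/negP; exact: no.
have pow j : a (2 ^ j)%N <= a 1%N + j%:R * (2 * e).
  elim: j => [|j IH]; first by rewrite expn0 mul0r addr0.
  by rewrite expnS mul2n -addnn -natr1 mulrDl mul1r; have := slow (2 ^ j)%N; lra.
pose B := L * (a 1%N + A + 4 * e + 1).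
have B0 : 0 <= A + a 1%N.
  have := lower 0%N; rewrite growth0 mul0r => h; have := growth_ge0 1%N; lra.
pose i := (Num.truncn B).+1.
have Bi : B < i%:R by rewrite truncnS_gt.
have big : (i * i <= 2 ^ (i + i))%N.
  by rewrite expnD leq_mul // ltnW // ltn_expl.
have := le_trans (lower (2 ^ (i + i))%N) (pow (i + i)%N).
rewrite lerBlDr ler_pdivrMr // => h.
have h2 : (i * i)%:R <= (2 ^ (i + i))%:R :> R by rewrite ler_nat.
rewrite natrM in h2; rewrite natrD in h.
have x1 : 1 <= i%:R :> R by rewrite ler1n.
have e0' := e0; have L0' := L0.
move: x1 Bi h h2; move: (i%:R) ((2 ^ _)%:R) => x p x1 Bx h h2.
have x0 : 0 < x by lra.
have h1 : x * B < x * x by rewrite ltr_pM2l.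
have h3 : L * (A + a 1%N) <= L * (A + a 1%N) * x by rewrite ler_peMr // mulr_ge0 // ltW.
have h4 : 0 < L * x by rewrite mulr_gt0.
have h5 := le_trans h2 h.
rewrite /B in h1; lra.
Qed.

(** The slope is the limit of a(n)/n. By subadditivity a(n) is at least the slope
times n, and iterating [growth_doubling] shows that a(m) exceeds 2^-j a(2^j m) by
at most [C]. *)
Lemma rough_geodesic : exists tau C, 0 < tau /\ forall n,
  tau * n%:R <= a n <= tau * n%:R + C.
Proof.
have [k /growth_doubling [C dbl]] := growth_gap_exists.
have C0 : 0 <= C by have := dbl 0%N; rewrite growth0; lra.
have pow j m : 2 ^+ j * a m <= a (2 ^ j * m)%N + (2 ^+ j - 1) * C.
  elim: j m => [|j IH] m; first by rewrite expn0 mul1n expr0; lra.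
  rewrite exprS expnS -mulnA mul2n -addnn.
  have := dbl (2 ^ j * m)%N; have := IH m.
  by nra.
have asym m n : (0 < n)%N -> (a m - C) * n%:R <= m%:R * a n.
  move=> n0; apply/ler_addgt0Pr => eps eps0.
  pose K := n%:R * (n%:R * a 1%N).
  have K0 : 0 <= K by rewrite !mulr_ge0 // growth_ge0.
  have [j jP] : exists j, K / eps < 2 ^+ j.
    exists (Num.truncn (K / eps)).+1.
    apply: lt_le_trans (truncnS_gt _) _.
    by rewrite -natrX ler_nat ltnW // ltn_expl.
  have p0 : 0 < 2 ^+ j :> R by rewrite exprn_gt0.
  set p : R := 2 ^+ j in jP p0.
  have Keps : K <= p * eps by rewrite -ler_pdivrMr // ltW.
  pose N := (2 ^ j * m)%N.
  have NR : N%:R = p * m%:R by rewrite /N natrM natrX.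
  have aN : n%:R * a N <= N%:R * a n + K.
    have h1 : a N <= (N %/ n)%:R * a n + n%:R * a 1%N.
      rewrite {1}(divn_eq N n); apply: le_trans (growthD _ _) _; apply: lerD.
        exact: growthM.
      apply: (@le_trans _ _ ((N %% n)%:R * a 1%N)).
        by have := growthM (N %% n) 1; rewrite muln1.
      by rewrite ler_wpM2r ?growth_ge0 // ler_nat ltnW // ltn_pmod.
    have h2 : n%:R * a N <= n%:R * ((N %/ n)%:R * a n + n%:R * a 1%N).
      by rewrite ler_wpM2l.
    apply: le_trans h2 _; rewrite mulrDr lerD2r mulrA -natrM.
    by rewrite ler_wpM2r ?growth_ge0 // ler_nat mulnC leq_divM.
  have pm : p * (a m - C) <= a N - C.
    by have := pow j m; rewrite -/N -/p; lra.
  have pm' : n%:R * (p * (a m - C)) <= n%:R * a N.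
    by rewrite ler_wpM2l //; lra.
  rewrite -(ler_pM2l p0); rewrite NR in aN.
  by lra.
pose S := [set t | exists2 m : nat, (0 < m)%N & t = (a m - C) / m%:R].
have Sub n : (0 < n)%N -> ubound S (a n / n%:R).
  move=> n0 _ [m m0 ->]; rewrite ler_pdivrMr ?ltr0n // mulrAC ler_pdivlMr ?ltr0n //.
  by rewrite [a n * _]mulrC; exact: asym.
have supS : has_sup S.
  by split; [exists ((a 1%N - C) / 1); exists 1%N|exists (a 1%N / 1%:R); exact: Sub].
have S_le m : (0 < m)%N -> a m <= sup S * m%:R + C.
  move=> m0; rewrite -lerBlDr -ler_pdivrMr ?ltr0n //.
  by apply: (ub_le_sup supS.2); exists m.
have le_S n : (0 < n)%N -> sup S * n%:R <= a n.
  by move=> n0; rewrite -ler_pdivlMr ?ltr0n //; apply: ge_sup supS.1 _; exact: Sub.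
exists (sup S), C; split; last first.
  case=> [|n]; first by rewrite growth0 !mulr0 add0r lexx.
  by rewrite le_S // S_le.
pose m := (Num.truncn (L * (A + C))).+1.
have Lm : L * (A + C) < m%:R by rewrite truncnS_gt.
have m0 : (0 < m%:R :> R) by rewrite ltr0n.
have : A + C < m%:R / L by rewrite ltr_pdivlMr // mulrC.
have := lower m; have := S_le m isT => h1 h2 h3.
by rewrite -(pmulr_lgt0 _ m0); lra.
Qed.

End RoughGeodesic.

(** * Limit rays and the Gromov boundary *)
Section LimitRay.
Context {R : realType} {X : metricType R}.
Local Notation d := mdist.
Variables (u : nat -> X) (e tau C : R).
Hypothesis geo : geodesic_space X.
Hypothesis X_proper : proper_space X.
Hypothesis four : forall x y z o : X,
  d x z + d y o <= d x y + d z o + e \/ d x z + d y o <= d x o + d y z + e.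
Hypothesis tau0 : 0 < tau.
Hypothesis u_rough : forall m n : nat, (m <= n)%N ->
  tau * (n - m)%N%:R <= d (u m) (u n) <= tau * (n - m)%N%:R + C.

(** A point at rough distance from the ends of a segment as if it were on it is
close to it, by the four point inequality. *)
Lemma near_segment m n s : (m <= n)%N -> geodesic_segment (u 0%N) (u n) s ->
  d (u m) (s (tau * m%:R)) <= 2 * C + e.
Proof.
move=> mn gs; have [s0 sn _] := gs.
have /andP[a1 a2] := u_rough (leq0n m); have /andP[b1 b2] := u_rough (leq0n n).
have /andP[c1 c2] := u_rough mn; rewrite !subn0 in a1 a2 b1 b2.
have nE : (n%:R : R) = m%:R + (n - m)%N%:R by rewrite -natrD subnKC.
rewrite nE mulrDr in b1 b2.
have t0 : 0 <= tau * m%:R by rewrite mulr_ge0 // ltW.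
have t0' : 0 <= tau * (n - m)%N%:R by rewrite mulr_ge0 // ltW.
set t := tau * m%:R in a1 a2 b1 b2 t0 *; set t' := tau * _ in b1 b2 c1 c2 t0'.
have tn : t <= d (u 0%N) (u n) by lra.
have h1 : d (u 0%N) (s t) = t by rewrite -{1}s0 (segment_dist gs) ?subr0.
have h2 : d (s t) (u n) = d (u 0%N) (u n) - t by rewrite -{1}sn (segment_dist gs).
have := four (u m) (u 0%N) (s t) (u n).
by rewrite h1 (metric_sym (u m) (u 0%N)) h2; move=> [h|h]; lra.
Qed.

(** The segments from [u 0] to [u n] have a pointwise limit along an ultrafilter,
because each of their values stays in a compact ball. *)
Lemma limit_ray : exists2 c : R -> X, geodesic_ray c &
  forall m : nat, d (u m) (c (tau * m%:R)) <= 2 * C + e + 1.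
Proof.
have /choice[s sP] : forall n, exists s, geodesic_segment (u 0%N) (u n) s.
  by move=> n; exact: geo.
have [U [UU sub]] := @ultraFilterLemma nat \oo _.
have far t : U [set n | t <= d (u 0%N) (u n)].
  apply: sub; exists (Num.truncn (t / tau)).+1 => // n /= tn.
  have /andP[un _] := u_rough (leq0n n); rewrite subn0 in un.
  apply: le_trans un; rewrite mulrC -ler_pdivrMr //.
  apply: (@le_trans _ _ (Num.truncn (t / tau)).+1%:R); last by rewrite ler_nat.
  by apply/ltW; rewrite truncnS_gt.
have /choice[c cP] : forall t : R, exists p : X, 0 <= t -> forall eps, 0 < eps ->
    U [set n | d (s n t) p < eps].
  move=> t; have [t0|t0] := leP 0 t; last by exists (u 0%N); lra.
  have FA : U [set n | d (u 0%N) (s n t) <= t].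
    apply: filterS (far t) => n /= tn; have [s0 _ _] := sP n.
    by rewrite -{1}s0 (segment_dist (sP n)) ?subr0.
  have [p [_ cl]] := @X_proper (u 0%N) t ((fun n => s n t) @ U) _ FA.
  exists p => _ eps eps0.
  have [//|nU] := in_ultra_setVsetC [set n | d (s n t) p < eps] UU.
  have [y [/= ny]] := cl [set y | ~ d y p < eps] (ball p eps) nU (nbhsx_ballx p eps eps0).
  by rewrite ballEmdist /= metric_sym => /ny.
exists c.
  move=> x t x0 t0.
  have key eps : 0 < eps -> exists n, [/\ d (s n x) (c x) < eps, d (s n t) (c t) < eps &
      d (s n x) (s n t) = `|x - t|].
    move=> eps0.
    have [n [[n1 n2] [n3 n4]]] := filter_ex (filterI
      (filterI (cP x x0 eps eps0) (cP t t0 eps eps0)) (filterI (far x) (far t))).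
    exists n; split=> //; have [_ _ sd] := sP n.
    by apply: sd; rewrite in_itv /= ?x0 ?t0.
  apply/eqP; rewrite eq_le; apply/andP; split; apply/ler_addgt0Pr => eps eps0.
    have [n [n1 n2 n3]] := key (eps / 2) (divr_gt0 eps0 (ltr0Sn R 1)).
    have := metric_triangle (c x) (s n x) (c t).
    have := metric_triangle (s n x) (s n t) (c t).
    by rewrite (metric_sym (c x) (s n x)) n3; lra.
  have [n [n1 n2 n3]] := key (eps / 2) (divr_gt0 eps0 (ltr0Sn R 1)).
  have := metric_triangle (s n x) (c x) (s n t).
  have := metric_triangle (c x) (c t) (s n t).
  by rewrite (metric_sym (c t) (s n t)) n3; lra.
move=> m; have t0 : 0 <= tau * m%:R by rewrite mulr_ge0 // ltW.
have Um : U [set n | (m <= n)%N] by apply: sub; exists m.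
have [n [/= n1 n2]] := filter_ex (filterI Um (cP _ t0 1 ltr01)).
have := metric_triangle (u m) (s n (tau * m%:R)) (c (tau * m%:R)).
by have := near_segment n1 (sP n); lra.
Qed.

End LimitRay.

Section GromovBoundary.
Context {R : realType} {X : metricType R}.
Local Notation d := mdist.
Local Notation gp := gromov_product.
Variables (u : nat -> X) (c' : R -> X) (k M : R).
Hypothesis ray' : geodesic_ray c'.
Hypothesis k0 : 0 < k.
Hypothesis track : forall n : nat, d (u n) (c' (k * n%:R)) <= M.

(** Along a single ray the Gromov product of c(s) and c(t) at the origin is the
smaller of s and t; the other data change it by a bounded amount. *)
Lemma cvg_gromov_tracking : cvg_gromov u (ray_class c').
Proof.
move=> c [cr [M1 cM1]] o A; pose M' := M + M1.
have kn0 n : 0 <= k * n%:R by rewrite mulr_ge0 // ltW.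
have uc n : d (u n) (c (k * n%:R)) <= M'.
  exact: le_trans (metric_triangle _ (c' (k * n%:R)) _) (lerD (track n) (cM1 _ (kn0 n))).
pose B := `|A| + M' + d o (c 0).
have B0 : 0 <= B.
  have h := le_trans (mdist_ge0 _ _) (uc 0%N).
  by rewrite /B; have := normr_ge0 A; have := mdist_ge0 o (c 0); lra.
have [N NP] : exists N : nat, forall n : nat, (N <= n)%N -> B <= k * n%:R.
  exists (Num.truncn (B / k)).+1 => n Nn.
  rewrite mulrC -ler_pdivrMr //; apply: (@le_trans _ _ (Num.truncn (B / k)).+1%:R).
    by apply/ltW; rewrite truncnS_gt.
  by rewrite ler_nat.
exists ([set n | (N <= n)%N], [set t | B <= t]) => /=.
  by split; [exists N|exact: (nbhs_pinfty_ge (num_real _))].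
move=> [n t] /= [Nn Bt]; have Bn := NP n Nn; have un := uc n.
have kn := kn0 n; set l := k * n%:R in Bn un kn.
have t0 : 0 <= t := le_trans B0 Bt.
have cl : d (c 0) (c l) = l by rewrite ray_dist ?subr0.
have ct : d (c 0) (c t) = t by rewrite ray_dist ?subr0.
have clt : d (c l) (c t) = `|l - t| by exact: cr.
have h1 := metric_triangle (u n) (c l) (c t).
have h2 := metric_triangle (c 0) o (c t).
have h3 := metric_triangle (c 0) o (u n).
have h4 := metric_triangle (c 0) (u n) (c l).
rewrite /gromov_product ler_pdivlMr //.
rewrite (metric_sym (u n) o) (metric_sym (c t) o).
rewrite (metric_sym (c 0) o) in h2 h3; rewrite ct in h2; rewrite cl in h4.
rewrite clt in h1; rewrite /B in Bn Bt; have := ler_norm A.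
by have [lt|tl] := leP l t; [rewrite ler0_norm in h1|rewrite gtr0_norm in h1]; lra.
Qed.

Variable e : R.
Hypothesis e0 : 0 <= e.
Hypothesis four : forall o x y z : X, gp o x y <= gp o x z + e \/ gp o y z <= gp o x z + e.

(** The product at [o] of c'(t) and c(t) is at least t up to a constant, by
the four point inequality along c'(t), u(n), c(T'), c(t) for n and T' large; both
points are at distance about t from [o], so they are close. *)
Lemma cvg_gromov_asymptotic c : geodesic_ray c ->
  cvg_gromov u (ray_class c) -> asymptotic c c'.
Proof.
move=> cr cv; pose o := c' 0; pose D := d o (c 0); pose Q := M + D + 2 * e.
have cc : ray_class c c by split=> //; exists 0 => t _; rewrite mdistxx.
have M0 : 0 <= M := le_trans (mdist_ge0 _ _) (track 0%N).
have D0 : 0 <= D := mdist_ge0 _ _.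
exists (D + 2 * Q) => t t0.
have [[F1 F2] /= [[N _ NP] [T [_ TP]]] FP] := cv c cc o t.
pose n := maxn N (Num.truncn (t / k)).+1.
pose T' := Num.max t (T + 1).
have gA : t <= gp o (u n) (c T').
  apply: (FP (n, T')); split=> /=; first by apply: NP; exact: leq_maxl.
  by apply: TP; rewrite lt_max ltrDl ltr01 orbT.
have tT : t <= T' by rewrite le_max lexx.
have tn : t <= k * n%:R.
  rewrite mulrC -ler_pdivrMr //; apply: (@le_trans _ _ (Num.truncn (t / k)).+1%:R).
    by apply/ltW; rewrite truncnS_gt.
  by rewrite ler_nat leq_maxr.
set l := k * n%:R in tn; have un := track n; rewrite -/l in un.
have l0 : 0 <= l := le_trans t0 tn.
have g1 : t - M <= gp o (c' t) (u n).
  have h1 : d (c' t) o = t by rewrite metric_sym ray_dist ?subr0.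
  have h2 : d o (c' l) = l by rewrite ray_dist ?subr0.
  have h3 : d (c' t) (c' l) = l - t by exact: ray_dist.
  have h4 := metric_triangle o (u n) (c' l); have h5 := metric_triangle (c' t) (c' l) (u n).
  rewrite (metric_sym (c' l)) in h5.
  by rewrite /gromov_product ler_pdivlMr // h1 (metric_sym (u n) o); lra.
have T0 : 0 <= T' := le_trans t0 tT.
have g2 : t - D <= gp o (c T') (c t).
  have h1 : d (c 0) (c t) = t by rewrite ray_dist ?subr0.
  have h2 : d (c 0) (c T') = T' by rewrite ray_dist ?subr0.
  have h3 : d (c t) (c T') = T' - t by exact: ray_dist.
  have h4 := metric_triangle (c 0) o (c t); have h5 := metric_triangle (c 0) o (c T').
  rewrite (metric_sym (c 0) o) -/D in h4 h5.
  rewrite /gromov_product ler_pdivlMr // (metric_sym (c T') (c t)) h3.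
  by rewrite (metric_sym (c t) o) (metric_sym (c T') o); lra.
have g3 : t - Q <= gp o (c' t) (c t).
  have e0' := e0; rewrite /Q; have [h|h] := four o (c' t) (c T') (c t); last by lra.
  by have [h'|h'] := four o (c' t) (u n) (c T'); lra.
have h1 : d (c' t) o = t by rewrite metric_sym ray_dist ?subr0.
have h2 : d (c 0) (c t) = t by rewrite ray_dist ?subr0.
have h3 := metric_triangle o (c 0) (c t); rewrite -/D h2 in h3.
move: g3; rewrite /gromov_product ler_pdivlMr // h1 (metric_sym (c t) o).
by rewrite (metric_sym (c' t)); lra.
Qed.

End GromovBoundary.

(** * The repelling point *)
Section RepellingRay.
Context {R : realType} {X : metricType R} {G : topologicalGroupType}.
Variable act : G -> X -> X.
Hypothesis isom : isometric_action act.
Variable g : G.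
Implicit Types (x y : X) (c : R -> X).
Local Notation d := mdist.

(** [repelling_point] is only a description: it denotes a boundary point with the
required limits once there is one, and uniqueness up to asymptotic rays is what
transfers the tracking from [c'] to its representatives. *)
Lemma repelling_of_ray (kd : npc_kind) (c' : R -> X) (tau : R) x0 :
  geodesic_ray c' -> 0 < tau ->
  (exists M, forall n : nat, d (act (g ^- n)%g x0) (c' (tau * n%:R)) <= M) ->
  (forall (u : nat -> X) (M : R), (forall n : nat, d (u n) (c' (tau * n%:R)) <= M) ->
    cvg_boundary kd u (ray_class c')) ->
  (forall c, geodesic_ray c ->
    cvg_boundary kd (fun n => act (g ^- n)%g x0) (ray_class c) -> asymptotic c c') ->
  boundary (repelling_point act kd g) /\
  forall y, exists c k M, [/\ repelling_point act kd g c, geodesic_ray c, 0 < k &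
    forall n : nat, d (act (g ^- n)%g y) (c (k * n%:R)) <= M].
Proof.
move=> ray' tau0 [M0 track0] cvg uniq.
have track y (n : nat) : d (act (g ^- n)%g y) (c' (tau * n%:R)) <= d y x0 + M0.
  apply: le_trans (metric_triangle _ (act (g ^- n)%g x0) _) _.
  by apply: lerD => //; rewrite (act_dist isom).
set P := [set xi | boundary xi /\
  forall x, cvg_boundary kd (fun n => act (g ^- n)%g x) xi].
have [[c cr cE] cv] : P (get P).
  apply: getPex; exists (ray_class c'); split; first by exists c'.
  by move=> x; apply: (cvg _ (d x x0 + M0)) => n; exact: track.
have xiE : repelling_point act kd g = ray_class c by rewrite cE.
split; first by rewrite xiE; exists c.
move=> y; have [B cB] : asymptotic c c' by apply: uniq => //; rewrite cE; exact: cv.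
exists c, tau, (d y x0 + M0 + B); split=> //.
  by rewrite xiE; split=> //; exists 0 => t _; rewrite mdistxx.
move=> n; apply: le_trans (metric_triangle _ (c' (tau * n%:R)) _) _.
apply: lerD => //; rewrite metric_sym; apply: cB.
by rewrite mulr_ge0 // ltW.
Qed.

Lemma CAT0_repelling_ray : CAT0_space X -> has_axis act g ->
  boundary (repelling_point act CAT0_kind g) /\
  forall y, exists c k M, [/\ repelling_point act CAT0_kind g c, geodesic_ray c, 0 < k &
    forall n : nat, d (act (g ^- n)%g y) (c (k * n%:R)) <= M].
Proof.
move=> cat0 [c [line [k k0 ck]]]; pose c' (t : R) := c (- t).
have ray' : geodesic_ray c'.
  by move=> s t _ _; rewrite /c' line -opprD normrN; congr (`|_|); ring.
have axis n : act (g ^- n)%g (c' 0) = c' (k * n%:R).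
  elim: n => [|n IH]; first by rewrite mulr0 expg0 invg1 (act1 isom).
  rewrite expgSr invgM (actM isom) IH /c' -natr1.
  have -> : - (k * n%:R) = - (k * (n%:R + 1)) + k by ring.
  by rewrite -ck (actK isom).
apply: (repelling_of_ray (c' := c') (tau := k) (x0 := c' 0)) => //.
- by exists 0 => n; rewrite axis mdistxx.
- by move=> u M tr; exact: (cvg_cone_tracking cat0 k0 tr).
- move=> c1 c1r cv; apply: (cvg_cone_asymptotic cat0 (k := k) ray' k0 c1r).
  have -> : (fun n : nat => c' (k * n%:R)) = fun n => act (g ^- n)%g (c' 0).
    by apply/funext => n; rewrite axis.
  exact: cv.
Qed.

Lemma hyperbolic_repelling_ray (delta : R) : 0 <= delta -> hyperbolic_space X delta ->
  proper_space X -> (exists x, qi_embedded_orbit act g x) ->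
  boundary (repelling_point act hyperbolic_kind g) /\
  forall y, exists c k M, [/\ repelling_point act hyperbolic_kind g c, geodesic_ray c, 0 < k &
    forall n : nat, d (act (g ^- n)%g y) (c (k * n%:R)) <= M].
Proof.
move=> delta0 hyp X_proper [x [L [A [L1 A0 qi]]]].
pose e := 3 * delta + 1; have e0 : 0 <= e by rewrite /e; lra.
pose u n := act (g ^- n)%g x; pose a n := d x (u n).
have ua m n : (m <= n)%N -> d (u m) (u n) = a (n - m)%N.
  move=> mn; rewrite /a -(act_dist isom (g ^- m)%g x) /u -(actM isom).
  by rewrite -invgM -expgnDr subnK.
have lower n : n%:R / L - A <= a n.
  have := qi n 0; rewrite subr0 => /andP[+ _].
  rewrite (act1 isom) /= mulrC.
  have -> : d (act (g ^+ n)%g x) x = a n.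
    by rewrite -(act_dist isom (g ^- n)%g) (actK isom).
  by [].
have four := four_point_dist delta0 hyp; rewrite -/e in four.
have e2 : 0 <= 2 * e by lra.
have L0 : 0 < L by lra.
have [tau [C [tau0 rough]]] := rough_geodesic e2 four ua L0 lower.
have u_rough m n : (m <= n)%N ->
    tau * (n - m)%N%:R <= d (u m) (u n) <= tau * (n - m)%N%:R + C.
  by move=> mn; rewrite ua.
have [c' ray' track] := limit_ray hyp.1 X_proper four tau0 u_rough.
apply: (repelling_of_ray (c' := c') (tau := tau) (x0 := x)) => //.
- by eexists; exact: track.
- by move=> v M tr; exact: (cvg_gromov_tracking tau0 tr).
- move=> c cr cv; apply: (cvg_gromov_asymptotic ray' tau0 track e0 _ cr cv).
  exact: four_point delta0 hyp.
Qed.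

Lemma repelling_ray (kd : npc_kind) : NPC_space kd X -> proper_space X ->
  hyperbolic_isometry act kd g ->
  boundary (repelling_point act kd g) /\
  forall y, exists c k M, [/\ repelling_point act kd g c, geodesic_ray c, 0 < k &
    forall n : nat, d (act (g ^- n)%g y) (c (k * n%:R)) <= M].
Proof.
case: kd => /= [[_ cat0] _ ax|[_ [delta d0 hyp]] X_proper qi].
  exact: CAT0_repelling_ray.
exact: (hyperbolic_repelling_ray d0 hyp X_proper).
Qed.

End RepellingRay.

(** * The theorem *)
Theorem corollary1p15 (R : realType) (X : metricType R) (k : npc_kind)
    (X_npc : NPC_space k X) (X_proper : proper_space X)
    (G : topologicalGroupType)
    (G_td : totally_disconnected [set: G]) (G_lc : locally_compact [set: G])
    (act : G -> X -> X) (act_isom : isometric_action act)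
    (act_proper : proper_action act)
    (act_ld : locally_discrete_action act)
    (g : G) (g_hyp : hyperbolic_isometry act k g)
    (Y : set X) (Y_nonempty : Y !=set0) (Y_closed : closed Y)
    (Y_convex : convex_subspace Y) (Y_inv : act g @` Y = Y)
    (K : set G) (K_def : K = fixator act Y) :
  [<-> closed (con g K);
       nub g `<=` fixator act Y;
       exists x : X, absorbing Y (repelling_point act k g)
         (fixed_points act (con g K `&` stabilizer act x));
       forall x : X, absorbing Y (repelling_point act k g)
         (fixed_points act (con g K `&` stabilizer act x))].
Proof.
subst K; have [y0 Yy0] := Y_nonempty.
have [xi_bd /(_ y0) [c [tau [M [xic cray tau0 track]]]]] :=
  repelling_ray act_isom X_npc X_proper g_hyp.
pose V := ball_fixator act Y y0.
have cV r : compact_open_subgroup (V r) by exact: co_ball_fixator.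
have decV r : V r.+1 `<=` V r := @ball_fixatorS _ _ _ act Y y0 r.
have KE : fixator act Y = \bigcap_r V r := bigcap_ball_fixator act Y y0.
have invK z h : fixator act Y h -> fixator act Y (conjz g z h).
  exact: fixator_inv.
have cS x : compact_open_subgroup (stabilizer act x) by exact: co_stabilizer.
have absP x : uniformly_contracted g (fixator act Y) V (stabilizer act x) <->
    absorbing Y (repelling_point act k g)
      (fixed_points act (con g (fixator act Y) `&` stabilizer act x)).
  split.
    by apply: (uniform_absorbing act_isom Y_inv xic tau0 track).
  exact: (absorbing_uniform act_isom Y_inv xi_bd xic tau0 track).
have unif_closed x :
    uniformly_contracted g (fixator act Y) V (stabilizer act x) ->
    closed (con g (fixator act Y)).
  exact: (closed_con cV decV KE (co_subgroup (cS x)) (co_open (cS x))).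
tfae.
- exact: (nub_sub_of_closed_con cV decV KE invK).
- move=> nubK; exists y0; apply/absP.
  exact: (uniform_of_nub_sub cV decV KE invK nubK (cS y0)).
- move=> [x /absP /unif_closed clC] y; apply/absP.
  apply: (uniform_of_nub_sub cV decV KE invK _ (cS y)).
  exact: (nub_sub_of_closed_con cV decV KE invK).
- by move=> /(_ y0) /absP /unif_closed.
Qed.
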